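(* Let $(\omega_i)_{i\in\mathbb{Z}}$ be i.i.d. with law $\eta$, and assume that there is $\varepsilon_0>0$ with $\eta(\varepsilon_0\le\omega_0\le 1-\varepsilon_0)=1$, that $\int \log\rho_0\,\eta(d\omega)=0$, and that $\operatorname{Var}(\log\rho_0)>0$, where $\rho_0=\frac{1-\omega_0}{\omega_0}$. Then for each real $\alpha>0$, $$\mathbb{E}\left(\tau_1^{\alpha}e^{-r\tau_1}\right)=\left(\frac1r\right)^{\alpha+o(1)},\qquad r\to0^+,$$ that is, $\dfrac{\log \mathbb{E}(\tau_1^\alpha e^{-r\tau_1})}{\log(1/r)}\to\alpha$ as $r\to 0^+$.
   Context: Given an environment $\omega=(\omega_i)_{i\in\mathbb{Z}}$, the random walk in random environment $(S_n)_{n\in\mathbb{N}}$ is the nearest-neighbour Markov chain on $\mathbb{Z}$ with $S_0=0$ and, under the quenched law $P_\omega$, $P_\omega(S_{n+1}=i+1\mid S_n=i)=\omega_i$, $P_\omega(S_{n+1}=i-1\mid S_n=i)=1-\omega_i$. The annealed law is $\mathbb{P}(\cdot):=\int P_\omega(\cdot)\,\eta(d\omega)$, and $\mathbb{E}$ is the corresponding expectation. For $a\in\mathbb{Z}$, $\tau_a:=\inf\{n>0:\ S_n=a\}$. *)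

(* Defs.v *)
From HB Require Import structures.
From mathcomp Require Import all_boot all_order all_algebra.
From mathcomp Require Import all_classical all_reals all_analysis.
Set Implicit Arguments.
Unset Strict Implicit.
Unset Printing Implicit Defensive.
Import Order.TTheory GRing.Theory Num.Theory.
Import numFieldNormedType.Exports.
Local Open Scope classical_set_scope.
Local Open Scope ring_scope.

HB.instance Definition _ := isPointed.Build int 0.

HB.instance Definition _ := @isMeasurable.Build default_measure_display
  int discrete_measurable discrete_measurable0
  discrete_measurableC discrete_measurableU.

(* Functions I -> T with the product sigma-algebra. *)
Definition prod_space (I : Type) d (T : measurableType d) : Type :=
  g_sigma_algebraType (\bigcup_(i in [set: I])
    preimage_set_system setT (fun f : I -> T => f i) measurable).

(* Environments (omega_i)_{i in Z}. *)
Definition env (R : realType) : Type := prod_space int R.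

(* Trajectories: the walk S_n is the n-th coordinate of s : traj. *)
Definition traj : Type := prod_space nat int.

Section rwre.
Variable R : realType.
Implicit Types (w : env R) (s : traj) (eta : probability (env R) R).

Definition iid_env eta : Prop :=
  (forall (J : seq int) (A : int -> set R), uniq J ->
     (forall i, measurable (A i)) ->
     eta [set w | forall i, i \in J -> A i (w i)] =
       (\prod_(i <- J) eta [set w | A i (w i)])%E) /\
  (forall (i : int) (A : set R), measurable A ->
     eta [set w | A (w i)] = eta [set w | A (w 0)]).

Definition rho (i : int) w : R := (1 - w i) / w i.

Definition step w (i j : int) : R :=
  if j == i + 1 then w i else if j == i - 1 then 1 - w i else 0.

(* Law of the Markov chain with transition matrix [step w] started at 0; the
   conditional probabilities given the past are written in product form, so
   that nothing is required when the past has probability zero. *)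
Definition is_quenched_law w (mu : {measure set traj -> \bar R}) : Prop :=
  mu [set s | s 0%N = 0] = 1%E /\
  forall (n : nat) (x : nat -> int),
    mu [set s | forall k, (k <= n.+1)%N -> s k = x k] =
    ((step w (x n) (x n.+1))%:E *
       mu [set s | forall k, (k <= n)%N -> s k = x k])%E.

Definition quenched_family (P : R.-pker (env R) ~> traj) : Prop :=
  forall w, (forall i, 0 <= w i <= 1) -> is_quenched_law w (P w).

Section annealed.
Variables (eta : probability (env R) R) (P : R.-pker (env R) ~> traj).

Definition annealed (B : set traj) : \bar R := (\int[eta]_w P w B)%E.

Let annealed0 : annealed set0 = 0%E.
Proof.
by rewrite /annealed (eq_integral (cst 0%E)) ?integral0// => w _; rewrite measure0.
Qed.

Let annealed_ge0 B : (0 <= annealed B)%E.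
Proof. exact: integral_ge0. Qed.

Let annealed_sigma_additive : semi_sigma_additive annealed.
Proof.
move=> F mF tF mUF; rewrite [X in _ --> X](_ : _ =
    (\int[eta]_w (\sum_(n <oo) P w (F n)))%E); last first.
  apply: eq_integral => w _.
  by apply/esym/cvg_lim => //; exact: measure_semi_sigma_additive.
rewrite integral_nneseries//; last first.
  by move=> n; exact: measurable_kernel.
by apply: is_cvg_nneseries => n _ _; exact: integral_ge0.
Qed.

HB.instance Definition _ := isMeasure.Build _ traj R annealed
  annealed0 annealed_ge0 annealed_sigma_additive.

Let annealed_setT : annealed setT = 1%E.
Proof.
rewrite /annealed (eq_integral (cst 1%E)) => [|w _]; last exact: prob_kernel.
by rewrite integral_cst// mul1e; exact: probability_setT.
Qed.

HB.instance Definition _ :=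
  Measure_isProbability.Build _ traj R annealed annealed_setT.

End annealed.

(* Equal to +oo when [a] is never hit. *)
Definition tau (a : int) s : \bar R :=
  ereal_inf [set n%:R%:E | n in [set n : nat | (0 < n)%N /\ s n = a]].

End rwre.

(* Main.v *)
Require Import Defs.
From HB Require Import structures.
From mathcomp Require Import all_boot all_order all_algebra.
From mathcomp Require Import all_classical all_reals all_analysis.
From mathcomp Require Import measurable_realfun.
From mathcomp Require Import ring lra zify.
Set Implicit Arguments.
Unset Strict Implicit.
Unset Printing Implicit Defensive.
Import Order.TTheory GRing.Theory Num.Theory.
Import numFieldNormedType.Exports.
Local Open Scope classical_set_scope.
Local Open Scope ring_scope.

(** Write l = log (1/r). The upper bound is deterministic: t ^ alpha * exp (- r t)
    is at most (alpha / r) ^ alpha for every t (powR_mul_expR_le).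

    For the lower bound it is enough that, for each small d, the hitting time of
    1 lies between r ^ (-(1 - 6 d)) and 1 / r with annealed probability at
    least r ^ (2 d), up to a constant factor. Let the potential at k be
    the sum of log rho over the sites 0, -1, ..., -(k-1); it is a centred random
    walk with bounded steps. Suppose that it climbs to (1 - 4 d) l
    before going below - d l, then descends to - 2 d l without exceeding
    (1 - 2 d) l, all in a number M of steps that is polynomial in l. Under such
    an environment explicit sub- and supersolutions of the recursion satisfied by
    the survival probabilities (surv_ge and surv_le) show that
    - the walk falls into the well and stays there longer than
      exp ((1 - 6 d) l) with probability at least about exp (- d l);
    - it survives up to time exp l with probability at most about
      exp (- 2 d l), because it can only do so by crossing the far wall or by
      staying inside much longer than expected.
    The difference is at least exp (- 2 d l) (quenched_window).

    Such environments have a probability bounded below by a constant that depends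
    on d only (deep_valley_probability). This is a two-stage gambler's ruin
    estimate: stop the potential walk when it leaves the prescribed region,
    compare the success probability with a piecewise linear function of the
    height, which is a submartingale (potential_increases), and control the
    duration by the second moment of the stopped walk (alive_prob_le). The
    only probabilistic input is that a site is independent of the previous ones
    (past_expectation), which comes from the product rule by Dynkin's theorem. *)

(** * Survival probabilities of a nearest-neighbour chain on a half-line *)

Section Quenched.
Variables (R : realType) (y E : nat -> R).

(** The chain lives on the nonnegative integers, is absorbed at 0, and steps
    from i.+1 towards 0 with probability y i. The walk in the environment w
    seen from its target 1 is of this form: the site - i of the line is the
    state i.+1, and y i = w (- i). *)
Fixpoint surv (n i : nat) : R :=
  if i is i'.+1 then
    if n is n'.+1 then y i' * surv n' i' + (1 - y i') * surv n' i'.+2 else 1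
  else 0.

(** With E the exponential of the potential, this is the scale function of the
    chain: it is harmonic because consecutive increments (E k)^-1 are in the
    ratio prescribed by the detailed balance equation yE below. *)
Definition scale (i : nat) : R := \sum_(k < i) (E k)^-1.

(** The probability, from i, of reaching the state m.+1 before absorption. *)
Definition reach (m i : nat) : R := scale (minn i m.+1) / scale m.+1.

Hypothesis y01 : forall i, 0 <= y i <= 1.
Hypothesis E_gt0 : forall i, 0 < E i.
Hypothesis E0 : E 0 = 1.
Hypothesis yE : forall i, y i * E i.+1 = (1 - y i) * E i.

Lemma surv0 n : surv n 0 = 0. Proof. by case: n. Qed.

Lemma survS n i :
  surv n.+1 i.+1 = y i * surv n i + (1 - y i) * surv n i.+2.
Proof. by []. Qed.

Lemma surv_itv n i : 0 <= surv n i <= 1.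
Proof.
elim: n i => [|n IH] [|i]; rewrite ?survS; rewrite /= ?lexx ?ler01//.
have /andP[] := IH i; have /andP[] := IH i.+2; have /andP[] := y01 i.
nra.
Qed.

Lemma scaleS i : scale i.+1 = scale i + (E i)^-1.
Proof. by rewrite /scale big_ord_recr. Qed.

Lemma scale_ge0 i : 0 <= scale i.
Proof. by apply: sumr_ge0 => k _; rewrite invr_ge0 ltW. Qed.

Lemma scale_homo : {homo scale : i j / (i <= j)%N >-> i <= j}.
Proof.
by apply: homo_leq => [//|i j k|i]; [exact: le_trans|];
  rewrite scaleS lerDl invr_ge0 ltW.
Qed.

Lemma scaleS_ge1 m : 1 <= scale m.+1.
Proof.
rewrite /scale big_ord_recl /= E0 invr1 lerDl.
by apply: sumr_ge0 => k _; rewrite invr_ge0 ltW.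
Qed.

Let scaleS_gt0 m : 0 < scale m.+1.
Proof. exact: lt_le_trans ltr01 (scaleS_ge1 m). Qed.

Lemma reach0 m : reach m 0 = 0.
Proof. by rewrite /reach min0n /scale big_ord0 mul0r. Qed.

Lemma reach1 m : reach m 1 = (scale m.+1)^-1.
Proof.
by rewrite /reach minnSS min0n {1}/scale big_ord1 E0 invr1 mul1r.
Qed.

Lemma reach_ge0 m i : 0 <= reach m i.
Proof. by rewrite divr_ge0 ?scale_ge0. Qed.

Lemma reach_far m i : (m < i)%N -> reach m i = 1.
Proof.
by move=> mi; rewrite /reach (minn_idPr mi) divff// gt_eqF.
Qed.

Lemma reach_le1 m i : reach m i <= 1.
Proof.
by rewrite ler_pdivrMr// mul1r; apply: scale_homo; rewrite geq_minr.
Qed.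

Let flux i : y i / E i = (1 - y i) / E i.+1.
Proof.
apply/eqP; rewrite eqr_div; last 2 first.
- by rewrite gt_eqF.
- by rewrite gt_eqF.
by rewrite yE.
Qed.

Lemma reach_harmonic m i : (i < m)%N ->
  reach m i.+1 = y i * reach m i + (1 - y i) * reach m i.+2.
Proof.
move=> im; rewrite /reach.
have -> : minn i.+1 m.+1 = i.+1 by lia.
have -> : minn i.+2 m.+1 = i.+2 by lia.
have -> : minn i m.+1 = i by lia.
rewrite !scaleS -/(scale m.+1); set s := scale i; set t := scale m.+1.
rewrite !mulrA -mulrDl; congr (_ / _).
have := flux i; set a := (E i)^-1; set b := (E i.+1)^-1 => f.
have : y i * a = (1 - y i) * b by [].
lra.
Qed.

Lemma reach_super m i :
  y i * reach m i + (1 - y i) * reach m i.+2 <= reach m i.+1.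
Proof.
case: (ltnP i m) => [im|mi]; first by rewrite -reach_harmonic.
rewrite (reach_far (i := i.+2)) ?(reach_far (i := i.+1)); [|lia..].
have := reach_le1 m i; have /andP[] := y01 i; nra.
Qed.

Lemma reach_sub m i :
  reach m i.+1 - (E m)^-1 <= y i * reach m i + (1 - y i) * reach m i.+2.
Proof.
have Em : 0 <= (E m)^-1 by rewrite invr_ge0 ltW.
case: (ltngtP i m) => [im|mi|->].
- by rewrite -reach_harmonic// gerBl.
- by rewrite !reach_far; [lra|lia..].
rewrite (reach_far (i := m.+2)) ?(reach_far (i := m.+1)); [|lia..].
have -> : reach m m = 1 - (E m)^-1 / scale m.+1.
  rewrite /reach (minn_idPl _)//.
  by rewrite -(divff (lt0r_neq0 (scaleS_gt0 m))) {2}scaleS; lra.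
have : (E m)^-1 / scale m.+1 <= (E m)^-1.
  by rewrite ler_pdivrMr// ler_peMr// scaleS_ge1.
have : 0 <= (E m)^-1 / scale m.+1 by rewrite divr_ge0// ltW.
have /andP[] := y01 m; nra.
Qed.

(** Subsolution bound. A walk that has reached the state m.+1 is treated as if
    it were safe; the only error is made at m.+1 itself, where each visit
    costs at most (E m)^-1, hence the loss n / E m after n steps. *)
Lemma surv_ge m n i : reach m i - n%:R / E m <= surv n i.
Proof.
elim: n i => [|n IH] [|i].
- by rewrite reach0 mul0r subr0.
- by rewrite mul0r subr0 reach_le1.
- by rewrite reach0 sub0r oppr_le0 divr_ge0// ltW.
rewrite survS -natr1 mulrDl mul1r.
have := reach_sub m i; have := IH i; have := IH i.+2; have /andP[] := y01 i.
set a := reach m i; set b := reach m i.+2; set c := reach m i.+1.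
set d := n%:R / _; nra.
Qed.

(** The expected absorption time, from i, of the chain reflected at N: at N it
    stays put instead of stepping to N.+1. *)
Definition exit_time (N i : nat) : R :=
  \sum_(k < minn i N) \sum_(k <= j < N) E j / E k / y j.

Lemma exit_time_ge0 N i : (forall j, 0 < y j) -> 0 <= exit_time N i.
Proof.
move=> y_gt0; apply: sumr_ge0 => k _; apply: sumr_ge0 => j _.
by rewrite !divr_ge0// ltW.
Qed.

Lemma exit_timeE N i : (forall j, 0 < y j) -> (i < N)%N ->
  y i * exit_time N i + (1 - y i) * exit_time N i.+2 = exit_time N i.+1 - 1.
Proof.
move=> y_gt0 iN; pose D k := \sum_(k <= j < N) E j / E k / y j.
have exitE k : (k <= N)%N -> exit_time N k = \sum_(l < k) D l.
  by move=> kN; rewrite /exit_time (minn_idPl kN).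
have exitS : exit_time N i.+2 = exit_time N i.+1 + D i.+1.
  case: (ltnP i.+1 N) => [i1N|Ni1].
    by rewrite !exitE ?big_ord_recr//=; lia.
  rewrite /D big_geq// addr0 /exit_time.
  by rewrite (_ : minn i.+2 N = minn i.+1 N)//; lia.
rewrite exitS (exitE i.+1)// (exitE i) ?(ltnW iN)// big_ord_recr /=.
have : y i * D i - (1 - y i) * D i.+1 = 1.
  rewrite /D big_ltn// divff ?lt0r_neq0// mulrDr mul1r divff ?lt0r_neq0//.
  rewrite !mulr_sumr [X in _ + X - _](_ : _ =
      \sum_(i.+1 <= j < N) (1 - y i) * (E j / E i.+1 / y j)) ?addrK//.
  apply: eq_bigr => j _.
  by rewrite -2!(mulrA (E j)) ![E j * _]mulrCA !mulrA flux.
lra.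
Qed.

(** Supersolution bound, a Markov inequality proved by induction on n: either
    the walk reaches N.+1, which has probability reach N i, or it follows the
    chain reflected at N, whose mean absorption time is exit_time N i. *)
Lemma surv_le N n i : (forall j, 0 < y j) ->
  n%:R * surv n i <= n%:R * reach N i + exit_time N i.
Proof.
move=> y_gt0; elim: n i => [|n IH] [|i].
- by rewrite !mul0r add0r exit_time_ge0.
- by rewrite !mul0r add0r exit_time_ge0.
- by rewrite reach0 !mulr0 add0r exit_time_ge0.
have /andP[_ s1] := surv_itv n.+1 i.+1.
case: (ltnP i N) => [iN|Ni]; last first.
  rewrite reach_far// (le_trans (ler_wpM2l _ s1))//.
  by rewrite lerDl exit_time_ge0.
rewrite survS -natr1.
have /andP[_] := surv_itv n i; have /andP[_] := surv_itv n i.+2.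
have := IH i; have := IH i.+2; have := exit_timeE y_gt0 iN.
have := reach_super N i; have := reach_ge0 N i.+1; have /andP[] := y01 i.
have : 0 <= n%:R :> R by [].
set a := reach N i; set b := reach N i.+2; set c := reach N i.+1.
set d := exit_time _ _; set e := exit_time _ _; set f := exit_time _ _.
set z := y i; set u := surv n i; set v := surv n i.+2; set m := n%:R.
move=> m0 z0 z1 c0 sup E1 I2 I1 v1 u1.
have h1 : z * (m * u) <= z * (m * a + d) by rewrite ler_wpM2l.
have h2 : (1 - z) * (m * v) <= (1 - z) * (m * b + e).
  by rewrite ler_wpM2l// subr_ge0.
have h3 : m * (z * a + (1 - z) * b) <= m * c by rewrite ler_wpM2l.
have h4 : z * u + (1 - z) * v <= 1 by nra.
lra.
Qed.

Lemma surv1_ge m n : (scale m.+1)^-1 - n%:R / E m <= surv n 1.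
Proof. by rewrite -reach1 surv_ge. Qed.

Lemma surv1_le N n : (forall j, 0 < y j) -> (0 < n)%N ->
  surv n 1 <= E N + (\sum_(j < N) E j / y j) / n%:R.
Proof.
move=> y_gt0 n0; have n0' : 0 < n%:R :> R by rewrite ltr0n.
have reachN : reach N 1 <= E N.
  rewrite reach1 -[leRHS]invrK lef_pV2 ?posrE ?invr_gt0//.
  by rewrite scaleS lerDr scale_ge0.
have exitN : exit_time N 1 = \sum_(j < N) E j / y j.
  rewrite /exit_time; case: N {reachN} => [|N]; first by rewrite minn0 !big_ord0.
  rewrite minnSS min0n big_ord1 big_mkord.
  by apply: eq_bigr => j _; rewrite E0 divr1.
rewrite -exitN -(ler_pM2l n0') mulrDr [n%:R * (_ / _)]mulrC divfK ?gt_eqF//.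
by rewrite (le_trans (surv_le N n 1 y_gt0))// lerD2r ler_wpM2l.
Qed.
End Quenched.

(** * The quenched law of the hitting time of 1 *)

Section Coordinates.
Context (I : Type) d (T : measurableType d).

Lemma measurable_coord (i : I) : measurable_fun setT (fun f : prod_space I T => f i).
Proof.
move=> _ B mB; apply: sub_sigma_algebra; exists i => //.
by exists B.
Qed.
End Coordinates.

Section QuenchedLaw.
Variables (R : realType) (w : env R) (mu : {measure set traj -> \bar R}).
Hypothesis w01 : forall i, 0 <= w i <= 1.
Hypothesis mu1 : mu setT = 1%E.
Hypothesis mu_law : is_quenched_law w mu.

Definition past_cyl (k : nat) (x : nat -> int) : set traj :=
  [set s | forall j, (j <= k)%N -> s j = x j].

Definition avoids (a : int) (k n : nat) : set traj :=
  [set s | forall j, (k < j <= n)%N -> s j <> a].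

Lemma measurable_traj_at (j : nat) (a : int) :
  measurable ([set s | s j = a] : set traj).
Proof.
rewrite (_ : [set s | _] = setT `&` (fun s : traj => s j) @^-1` [set a]).
  by apply: measurable_coord.
by rewrite setTI.
Qed.

Lemma measurable_past_cyl k x : measurable (past_cyl k x).
Proof.
rewrite (_ : past_cyl k x = \bigcap_(j in [set j | (j <= k)%N]) [set s : traj | s j = x j]).
  by apply: bigcap_measurable => [|j _]; [exists 0%N|exact: measurable_traj_at].
by apply/seteqP; split => s.
Qed.

Lemma measurable_avoids a k n : measurable (avoids a k n).
Proof.
rewrite (_ : avoids a k n =
  \bigcap_(j in [set j | (k < j <= n)%N]) ~` [set s : traj | s j = a]).
  apply: bigcap_measurableType => j _.
  by apply: measurableC; exact: measurable_traj_at.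
by apply/seteqP; split => s.
Qed.


(** Two pieces that carry all the mass of C are enough to compute the measure
    of a subset of C: this discards the paths that do not make a
    nearest-neighbour step, whose total mass is zero. *)
Lemma measure_two_branches (A C B1 B2 : set traj) :
  measurable A -> measurable C -> measurable B1 -> measurable B2 ->
  A `<=` C -> B1 `<=` C -> B2 `<=` C -> B1 `&` B2 = set0 ->
  (mu C = mu B1 + mu B2)%E ->
  (mu A = mu (A `&` B1) + mu (A `&` B2))%E.
Proof.
move=> mA mC mB1 mB2 AC B1C B2C B12 muC.
have mB : measurable (B1 `|` B2) by exact: measurableU.
have muU : mu (B1 `|` B2) = mu C.
  by rewrite muC measureU//; exact/eqP.
have fin : (mu C < +oo)%E.
  have : (mu C <= mu setT)%E by apply: le_measure; rewrite ?inE.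
  by rewrite mu1 => /le_lt_trans; apply; rewrite ltry.
have restC : mu (C `\` (B1 `|` B2)) = 0%E.
  have -> : mu (C `\` (B1 `|` B2)) = (mu C - mu (C `&` (B1 `|` B2)))%E.
    exact: measureD.
  rewrite [C `&` _]setIidr; last by rewrite subUset.
  by rewrite muU subee// ge0_fin_numE.
have rest0 : mu (A `\` (B1 `|` B2)) = 0%E.
  apply: (@subset_measure0 _ _ _ _ _ (C `\` (B1 `|` B2))).
  - exact: measurableD.
  - exact: measurableD.
  - by apply: setSD.
  - exact: restC.
have -> : (mu A = mu (A `\` (B1 `|` B2)) + mu (A `&` (B1 `|` B2)))%E.
  exact: measureDI.
rewrite rest0 add0e setIUr measureU//.
- exact: measurableI.
- exact: measurableI.
- by rewrite setIACA B12 setI0.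
Qed.

Let y (i : nat) : R := w (- i%:Z).

Let upd (x : nat -> int) k a j := if j == k then a else x j.

Let past_cyl_upd k x a :
  past_cyl k.+1 (upd x k.+1 a) = past_cyl k x `&` [set s | s k.+1 = a].
Proof.
apply/seteqP; split => [s xs|s [xs sa] j]; [split|].
- by move=> j jk; rewrite xs ?leqW// /upd ltn_eqF.
- by have := xs _ (leqnn _); rewrite /upd eqxx.
- by rewrite /upd leq_eqVlt; case: eqVneq => [->|_ /xs].
Qed.

(** The Markov property in product form: conditioning on the first step turns
    the recursion of the cylinder probabilities into that of surv. *)
Lemma quenched_survival_from n k x i : x k = - i%:Z ->
  mu (past_cyl k x `&` avoids 1 k (k + n)) =
  (mu (past_cyl k x) * (surv y n i.+1)%:E)%E.
Proof.
elim: n k x i => [|n IH] k x i xk.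
  rewrite addn0 mule1 (_ : avoids _ _ _ = setT) ?setIT//.
  by apply/seteqP; split => // s _ j; lia.
have [_ step_law] := mu_law.
pose B a := past_cyl k.+1 (upd x k.+1 a).
have mB a : measurable (B a) by exact: measurable_past_cyl.
have muB a : mu (B a) = ((step w (- i%:Z) a)%:E * mu (past_cyl k x))%E.
  rewrite /B /past_cyl step_law /upd eqxx (ltn_eqF (ltnSn k)) xk.
  congr (_ * mu _)%E; apply/seteqP; split => s xs j jk.
    by rewrite xs// ltn_eqF.
  by rewrite xs// ltn_eqF.
have BC a : B a `<=` past_cyl k x by rewrite /B past_cyl_upd; exact: subIsetl.
have mC := measurable_past_cyl k x.
have /andP[y0 y1] : 0 <= y i <= 1 by exact: w01.
have y1' : 0 <= 1 - y i by rewrite subr_ge0.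
have muBr : mu (B (1 - i%:Z)) = ((y i)%:E * mu (past_cyl k x))%E.
  by rewrite muB /step addrC eqxx.
have muBl : mu (B (- 1 - i%:Z)) = ((1 - y i)%:E * mu (past_cyl k x))%E.
  rewrite muB /step ifF; last by apply/eqP; lia.
  by rewrite addrC eqxx.
rewrite (@measure_two_branches _ _ (B (1 - i%:Z)) (B (- 1 - i%:Z)) _ mC)//.
- have w01' j : 0 <= y j <= 1 by exact: w01.
  have /andP[u0 _] := surv_itv w01' n i; have /andP[v0 _] := surv_itv w01' n i.+2.
  have avoidS s a : a <> 1 -> s k.+1 = a -> avoids 1 k (k + n.+1) s <-> avoids 1 k.+1 (k.+1 + n) s.
    move=> a1 sa; rewrite addSnnS; split => [h j jk|h j jk]; first by apply: h; lia.
    have [jk1|jk1] := eqVneq j k.+1; first by rewrite jk1 sa.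
    by apply: h; lia.
  have branch a : a <> 1 -> past_cyl k x `&` avoids 1 k (k + n.+1) `&` B a =
      B a `&` avoids 1 k.+1 (k.+1 + n).
    move=> a1; apply/seteqP; split => s.
      move=> [[_ av] Bs]; split => //; move: (Bs); rewrite /B past_cyl_upd.
      by move=> [_ sa]; apply/(avoidS s a).
    move=> [Bs av]; split => //; move: (Bs); rewrite /B past_cyl_upd.
    by move=> [Cs sa]; split => //; apply/(avoidS s a).
  rewrite (branch (- 1 - i%:Z)); last by lia.
  rewrite /B (IH _ _ i.+1); last by rewrite /upd eqxx; lia.
  rewrite -/(B (- 1 - i%:Z)) muBl survS.
  rewrite [X in (X + _)%E](_ : _ =
      ((y i)%:E * mu (past_cyl k x) * (surv y n i)%:E)%E); last first.
    (* From the site 0 a step to the right hits 1, so this branch is empty. *)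
    destruct i as [|i].
      rewrite surv0 mule0 [X in mu X](_ : _ = set0) ?measure0//.
      apply/seteqP; split => // s [[_ av]].
      rewrite /B past_cyl_upd => -[_] /= s1.
      by apply: (av k.+1); [lia|rewrite s1 subr0].
    rewrite branch; last by lia.
    rewrite /B (IH _ _ i); last by rewrite /upd eqxx; lia.
    by rewrite -/(B (1 - i.+1%:Z)) muBr.
  rewrite [in RHS]EFinD ge0_muleDr ?lee_fin ?mulr_ge0//.
  by rewrite !EFinM !muleA !(muleC (mu _)).
- by apply: measurableI => //; exact: measurable_avoids.
- apply/seteqP; split => // s; rewrite /B !past_cyl_upd => -[[_ s1] [_ s2]].
  by move: s1 s2 => /= ->; lia.
- by rewrite muBr muBl -ge0_muleDl ?lee_fin// -EFinD addrC subrK mul1e.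
Qed.

Lemma quenched_survival n : mu (avoids 1 0 n) = (surv y n 1)%:E.
Proof.
have [init _] := mu_law.
pose Z := [set s : traj | s 0%N = 0].
have cyl0 : past_cyl 0 (fun=> 0) = Z.
  apply/seteqP; split => s /=; first exact.
  by move=> s0 j; rewrite leqn0 => /eqP ->.
have mi : measurable Z by exact: measurable_traj_at.
have ma : measurable (avoids 1 0 n) by exact: measurable_avoids.
have := @quenched_survival_from n 0 (fun=> 0) 0 erefl.
rewrite cyl0 [mu Z]init mul1e add0n => <-.
have -> : (mu (avoids 1 0 n) = mu (avoids 1 0 n `\` Z) +
    mu (avoids 1 0 n `&` Z))%E by exact: measureDI.
rewrite setIC [X in (X + _)%E](_ : _ = 0%E) ?add0e//.
apply: (@subset_measure0 _ _ _ _ _ (~` Z)).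
- exact: measurableD.
- exact: measurableC.
- by move=> s [].
- have : mu (~` Z) = (mu setT - mu Z)%E.
    rewrite -setTD -[in RHS](setTI Z).
    have fin : (mu setT < +oo)%E by rewrite mu1 ltry.
    by apply: measureD.
  by rewrite mu1 [mu Z]init subee.
Qed.
End QuenchedLaw.

(** * Independence of a site from the sites already visited *)

Section PastSigmaAlgebra.
Variable R : realType.

(** Only the sites 0, -1, -2, ... matter for the hitting time of 1. *)
Definition box (k : nat) (B : nat -> set R) : set (env R) :=
  [set w : env R | forall j, (j < k)%N -> B j (w (- j%:Z))].

Definition boxes (k : nat) : set (set (env R)) :=
  [set A | exists2 B, (forall j, measurable (B j)) & A = box k B].

Definition past (k : nat) := g_sigma_algebraType (boxes k).

Lemma boxes_setI k : setI_closed (boxes k).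
Proof.
move=> _ _ [B mB ->] [C mC ->]; exists (fun j => B j `&` C j).
  by move=> j; exact: measurableI.
apply/seteqP; split => w.
  by move=> [h1 h2] j jk; split; [exact: h1|exact: h2].
by move=> h; split => j jk; have [] := h j jk.
Qed.

Lemma measurable_site (i : int) :
  measurable_fun setT (fun w : env R => w i).
Proof. exact: measurable_coord. Qed.

Lemma measurable_site_preim (i : int) (B : set R) : measurable B ->
  measurable ([set w : env R | B (w i)] : set (env R)).
Proof.
by move=> mB; rewrite -[X in measurable X]setTI; exact: measurable_site.
Qed.

Lemma measurable_box k B : (forall j, measurable (B j)) ->
  measurable (box k B : set (env R)).
Proof.
move=> mB; rewrite (_ : box k B =
  \bigcap_(j in [set j | (j < k)%N]) [set w : env R | B j (w (- j%:Z))]).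
  by apply: bigcap_measurableType => j _; exact: measurable_site_preim.
by apply/seteqP; split => w.
Qed.

Lemma past_measurable k (A : set (past k)) :
  measurable A -> measurable (A : set (env R)).
Proof.
apply: smallest_sub; first exact: (@sigma_algebra_measurable _ (env R)).
by move=> _ [B mB ->]; exact: measurable_box.
Qed.

Lemma past_measurable_fun k d (T : measurableType d) (f : env R -> T) :
  measurable_fun setT (f : past k -> T) -> measurable_fun setT f.
Proof. by move=> mf _ B mB; apply: past_measurable; exact: mf. Qed.

Lemma past_fun_widen k d (T : measurableType d) (f : env R -> T) :
  measurable_fun setT (f : past k -> T) ->
  measurable_fun setT (f : past k.+1 -> T).
Proof.
move=> mf _ B mB; have := mf measurableT B mB.
apply: smallest_sub; first exact: (@sigma_algebra_measurable _ (past k.+1)).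
move=> _ [C mC ->]; apply: sub_sigma_algebra.
exists (fun j => if (j < k)%N then C j else setT).
  by move=> j; case: ifP.
apply/seteqP; split => w h j jk; first by case: ifP => // /h.
by have := h j (leqW jk); rewrite jk.
Qed.

Lemma measurable_past_site k :
  measurable_fun setT ((fun w => w (- k%:Z)) : past k.+1 -> R).
Proof.
move=> _ B mB; apply: sub_sigma_algebra.
exists (fun j => if j == k then B else setT) => [j|]; first by case: ifP.
apply/seteqP; split => w /=.
  by move=> [_ Bw] j _; case: eqP => // ->.
by move=> h; split => //; have := h k (leqnn _); rewrite eqxx.
Qed.

Variable eta : probability (env R) R.
Hypothesis iid : iid_env eta.

Lemma site_law (i : int) (B : set R) : measurable B ->
  eta [set w : env R | B (w i)] = eta [set w : env R | B (w 0%R)].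
Proof. by have [_] := iid; apply. Qed.

Lemma box_indep k (B : nat -> set R) (C : set R) :
  (forall j, measurable (B j)) -> measurable C ->
  eta (box k B `&` [set w : env R | C (w (- k%:Z)%R)]) =
  (eta (box k B) * eta [set w : env R | C (w 0%R)])%E.
Proof.
move=> mB mC; have [prodE _] := iid.
pose J := [seq - j%:Z | j <- iota 0 k].
pose A i := if i == - k%:Z then C else B `|i|%N.
have kJ : - k%:Z \notin J.
  by apply/mapP => -[j]; rewrite mem_iota => /andP[_ jk] /eqP; lia.
have uJ : uniq J by rewrite map_inj_uniq ?iota_uniq// => a b; lia.
have mA i : measurable (A i) by rewrite /A; case: ifP.
have boxE : box k B = [set w : env R | forall i, i \in J -> A i (w i)].
  apply/seteqP; split => w h.
    move=> i /[dup] iJ /mapP[j]; rewrite mem_iota => /andP[_ jk] ij.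
    rewrite /A ifF; last by apply/eqP => ik; move: iJ kJ; rewrite ik => ->.
    by have := h j jk; rewrite ij abszN absz_nat.
  move=> j jk; have := h (- j%:Z); rewrite /A ifF; last by apply/eqP; lia.
  by rewrite abszN absz_nat; apply; apply: map_f; rewrite mem_iota.
have -> : box k B `&` [set w : env R | C (w (- k%:Z)%R)] =
    [set w : env R | forall i, i \in - k%:Z :: J -> A i (w i)].
  rewrite boxE; apply/seteqP; split => w.
    move=> [h Cw] i; rewrite inE => /orP[/eqP ->|/h//].
    by rewrite /A eqxx.
  move=> h; split => [i iJ|]; first by apply: h; rewrite inE iJ orbT.
  by have := h (- k%:Z); rewrite /A eqxx; apply; rewrite inE eqxx.
rewrite boxE !prodE//=; last by rewrite kJ.
by rewrite big_cons muleC /A eqxx site_law.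
Qed.

(** The product rule of the environment gives this on boxes, which form a
    pi-system; Dynkin's theorem extends it to the generated sigma-algebra. *)
Lemma past_indep k (A : set (past k)) (C : set R) :
  measurable A -> measurable C ->
  eta (A `&` [set w : env R | C (w (- k%:Z)%R)]) =
    (eta A * eta [set w : env R | C (w 0%R)])%E.
Proof.
move=> mA mC; pose H : set (set (env R)) := [set A | measurable A /\
  eta (A `&` [set w : env R | C (w (- k%:Z)%R)]) =
    (eta A * eta [set w : env R | C (w 0%R)])%E].
suff : H A by case.
have mCk : measurable ([set w : env R | C (w (- k%:Z)%R)] : set (env R)).
  exact: measurable_site_preim.
apply: (@lambda_system_subset _ (boxes k) (@boxes_setI k) setT H) => //.
  apply/dynkin_lambda_system; split.
  - split; first exact: measurableT.
    by rewrite setTI probability_setT mul1e site_law.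
  - move=> B [mB BE]; split; first exact: measurableC.
    set D := [set w : env R | C (w (- k%:Z)%R)] in mCk BE *.
    have fin : (eta D < +oo)%E by rewrite (le_lt_trans (probability_le1 eta mCk)) ?ltry.
    have -> : (eta (~` B `&` D) = eta D - eta (D `&` B))%E.
      by rewrite setIC -setDE; exact: measureD.
    rewrite [D `&` B]setIC BE probability_setC// muleBl ?mul1e ?site_law//.
    by rewrite fin_num_measure//; exact: measurable_site_preim.
  - move=> F tF HF; have mF n : measurable (F n : set (env R)) by case: (HF n).
    split; first exact: bigcup_measurable.
    set D := [set w : env R | C (w (- k%:Z)%R)] in mCk HF *.
    have -> : (eta (\bigcup_n F n `&` D) = \sum_(n <oo) eta (F n `&` D))%E.
      rewrite setI_bigcupl measure_bigcup//.
        by apply: eq_eseriesl => n; rewrite in_setT.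
      by move=> n _; exact: measurableI.
      exact: trivIset_setIr.
    have -> : (eta (\bigcup_n F n) = \sum_(n <oo) eta (F n))%E.
      rewrite measure_bigcup//.
      by apply: eq_eseriesl => n; rewrite in_setT.
    have cfin : eta [set w : env R | C (w 0%R)] \is a fin_num.
      by rewrite fin_num_measure//; exact: measurable_site_preim.
    rewrite muleC -(fineK cfin) -nneseriesZl//.
    by apply: eq_eseriesr => n _; case: (HF n) => _ ->; rewrite fineK// muleC.
move=> _ [B mB ->]; split; first exact: measurable_box.
exact: box_indep.
Qed.
End PastSigmaAlgebra.

Section BoundedIntegrals.
Context d (T : measurableType d) (R : realType) (mu : probability T R).

Lemma bounded_integrable (f : T -> R) (M : R) :
  measurable_fun setT f -> (forall x, `|f x| <= M) ->
  mu.-integrable setT (EFin \o f).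
Proof.
move=> mf fM; apply: measurable_bounded_integrable => //.
  by rewrite (le_lt_trans (probability_le1 mu measurableT)) ?ltry.
exists M; split; first exact: num_real.
by move=> r Mr x _; exact: le_trans (fM x) (ltW Mr).
Qed.

Implicit Types f g : T -> R.

Definition bounded_mfun f :=
  measurable_fun setT f /\ exists M, forall x, `|f x| <= M.

Lemma bounded_mfun_integrable f : bounded_mfun f ->
  mu.-integrable setT (EFin \o f).
Proof. by move=> [mf [M fM]]; exact: bounded_integrable fM. Qed.

Lemma bounded_mfunD f g : bounded_mfun f -> bounded_mfun g ->
  bounded_mfun (fun x => f x + g x).
Proof.
move=> [mf [M fM]] [mg [N gN]]; split; first exact: measurable_funD.
by exists (M + N) => x; rewrite (le_trans (ler_normD _ _))// lerD.
Qed.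

Lemma bounded_mfunM f g : bounded_mfun f -> bounded_mfun g ->
  bounded_mfun (fun x => f x * g x).
Proof.
move=> [mf [M fM]] [mg [N gN]]; split; first exact: measurable_funM.
by exists (M * N) => x; rewrite normrM ler_pM.
Qed.

Lemma bounded_mfun_cst c : bounded_mfun (cst c).
Proof. by split; [exact: measurable_cst|exists `|c|]. Qed.

Lemma bounded_mfun_indic (b : T -> bool) : measurable_fun setT b ->
  bounded_mfun (fun x => (b x)%:R).
Proof.
move=> mb; split; last by exists 1 => x; case: (b x); rewrite ?normr1 ?normr0.
rewrite (_ : (fun x => _) = (fun x => if b x then 1 else 0)).
  by apply: measurable_fun_ifT.
by apply/funext => x; case: (b x).
Qed.

Lemma mean_cst (c : R) : \int[mu]_x c = c.
Proof.
have mu1 : fine (mu setT) = 1 by rewrite probability_setT.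
by rewrite Rintegral_cst// [X in _ * X]mu1 mulr1.
Qed.

Lemma mean_indic (b : T -> bool) : measurable_fun setT b ->
  \int[mu]_x (b x)%:R = fine (mu [set x | b x]).
Proof.
move=> mb; have mB : measurable [set x | b x].
  by rewrite -[X in measurable X]setTI; exact: mb measurableT [set true] _.
rewrite /Rintegral; congr fine; rewrite -[RHS]mul1e -(setIT [set x | b x]).
rewrite -integral_indic// mul1e; apply: eq_integral => x _.
rewrite indicE; case: (boolP (b x)) => bx; first by rewrite mem_set.
by rewrite memNset//; exact/negP.
Qed.

End BoundedIntegrals.

Section PastExpectation.
Variables (R : realType) (eta : probability (env R) R).
Hypothesis iid : iid_env eta.

(** By independence the joint law of Y and of the site - k is a product, so
    this is Fubini's theorem. *)
Lemma past_expectation k (Y : env R -> R) (g : R -> R) (M1 M2 : R) :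
  measurable_fun setT (Y : past R k -> R) -> (forall w, `|Y w| <= M1) ->
  measurable_fun setT g -> (forall x, `|g x| <= M2) ->
  \int[eta]_w (Y w * g (w (- k%:Z))) =
  (\int[eta]_w Y w) * \int[eta]_w g (w 0).
Proof.
move=> mY bY mg bg; have mY' := past_measurable_fun mY.
pose X (w : env R) : R := w (- k%:Z).
have mX : measurable_fun setT X by exact: measurable_site.
have mX0 : measurable_fun setT (fun w : env R => w 0) by exact: measurable_site.
pose YX w := (Y w, X w).
have mYX : measurable_fun setT YX by exact/measurable_fun_pair.
pose mY_ : {mfun _ >-> _} := mfun_Sub (mem_set mY').
pose mX_ : {mfun _ >-> _} := mfun_Sub (mem_set mX0).
pose mYX_ : {mfun _ >-> _} := mfun_Sub (mem_set mYX).
pose m1 := distribution eta mY_.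
pose m2 := distribution eta mX_.
pose m := distribution eta mYX_.
(* Truncating the first factor at M1 does not change it on the range of Y, and
   makes the integrand bounded on the whole plane. *)
pose cl (y : R) := Num.max (- M1) (Num.min y M1).
have M1_ge0 : 0 <= M1 by exact: le_trans (normr_ge0 _) (bY point).
have M2_ge0 : 0 <= M2 by exact: le_trans (normr_ge0 _) (bg 0).
have mcl : measurable_fun setT cl.
  apply: (@measurable_maxr _ _ R setT (cst (- M1))) => //.
  exact: (@measurable_minr _ _ R setT id (cst M1)).
have bcl y : `|cl y| <= M1.
  by rewrite ler_norml /cl; rewrite le_max lexx /= ge_max ge_min lexx orbT; lra.
have clY w : cl (Y w) = Y w.
  have := bY w; rewrite ler_norml => /andP[Y1 Y2].
  by rewrite /cl (min_idPl Y2) (max_idPr Y1).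
pose h (z : R * R) := cl z.1 * g z.2.
have mh : measurable_fun setT h.
  apply: measurable_funM; first exact: measurableT_comp mcl measurable_fst.
  exact: measurableT_comp mg measurable_snd.
have bh z : `|h z| <= M1 * M2 by rewrite normrM ler_pM.
have m_prod A : measurable A -> (m1 \x m2)%E A = m A.
  apply: product_measure_unique => B C mB mC.
  apply: (past_indep iid (A := Y @^-1` B)) => //.
  by rewrite -[X in measurable X]setTI; exact: mY.
have E1 : (\int[eta]_w (Y w * g (X w))%:E = \int[m]_z (h z)%:E)%E.
  rewrite integral_distribution//.
  - by apply: eq_integral => w _; rewrite /h /= clY.
  - exact/measurable_EFinP.
  - apply: (@bounded_integrable _ _ _ eta (h \o YX) (M1 * M2)) => //.
      exact: measurableT_comp mh mYX.
    by move=> w; exact: bh.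
have E2 : (\int[m]_z (h z)%:E = \int[(m1 \x m2)%E]_z (h z)%:E)%E.
  by apply: eq_measure_integral => A mA _; exact/esym/m_prod.
have ih : (m1 \x m2)%E.-integrable setT (EFin \o h).
  apply: (@measurable_bounded_integrable _ _ _ (m1 \x m2)%E) => //.
    by rewrite (le_lt_trans _ (ltry 1))// [leLHS]m_prod// probability_le1.
  exists (M1 * M2); split; first exact: num_real.
  by move=> r Mr x _; exact: le_trans (bh x) (ltW Mr).
have ig : m2.-integrable setT (EFin \o g) by exact: bounded_integrable bg.
have E3 : (\int[(m1 \x m2)%E]_z (h z)%:E =
    \int[m1]_y ((cl y)%:E * \int[m2]_x (g x)%:E))%E.
  rewrite -integral12_prod_meas1//; apply: eq_integral => y _.
  by rewrite /= -integralZl//; apply: eq_integral => x _; rewrite EFinM.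
have icl : m1.-integrable setT (EFin \o cl) by exact: bounded_integrable bcl.
rewrite /Rintegral E1 E2 E3.
have gfin : (\int[m2]_x (g x)%:E)%E \is a fin_num by exact: integrable_fin_num ig.
rewrite -(fineK gfin) integralZr// fineM//; last exact: integrable_fin_num icl.
congr (fine _ * _).
  rewrite integral_distribution//; last first.
  - apply: (@bounded_integrable _ _ _ eta (cl \o Y) M1) => [|w]; last exact: bcl.
    exact: measurableT_comp mcl mY'.
  - exact/measurable_EFinP.
  - by apply: eq_integral => w _; rewrite /= clY.
rewrite /= integral_distribution//; first exact/measurable_EFinP.
apply: (@bounded_integrable _ _ _ eta (fun w => g (w 0)) M2) => //.
exact: measurableT_comp mg mX0.
Qed.
End PastExpectation.

(** * Potentials with a deep valley: the stopped walk *)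

Section ValleyPath.
Variables (R : realType) (lo1 hi1 lo2 hi2 : R).
Implicit Types (s : bool * R) (x : nat -> R).

(** A state records whether the level hi1 has been reached, and the current
    height. In the first phase the walk is stopped at or below lo1; in the second
    one it is stopped on leaving the interval from lo2 to hi2. *)
Definition alive s : bool :=
  if s.1 then (lo2 < s.2) && (s.2 < hi2) else lo1 < s.2.

Definition stopped_step s (dx : R) : bool * R :=
  if alive s then (s.1 || (hi1 <= s.2 + dx), s.2 + dx) else s.

Fixpoint state x k : bool * R :=
  if k is k'.+1 then stopped_step (state x k') (x k') else (false, 0).

Definition walk x k : R := \sum_(j < k) x j.

(** When x lists the log-odds of a step to the left at 0, -1, -2, ..., this
    describes a trap: the random walk is pushed away from its target as long as
    the partial sums climb to hi1, and pushed back towards 0 as they go down to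
    lo2. *)
Definition has_valley x (M : nat) : Prop := exists m N,
  [/\ (m <= N <= M)%N, forall j, (j <= m)%N -> lo1 < walk x j,
      hi1 <= walk x m, forall j, (j < N)%N -> walk x j < hi2 &
      walk x N <= lo2].

Definition in_valley s : bool := s.1 && (s.2 <= lo2).

Variable C : R.
Hypotheses (C_ge0 : 0 <= C) (lo1_lt0 : lo1 < 0) (hi1_gt0 : 0 < hi1).
Hypotheses (lo21 : lo2 <= lo1) (hi12 : hi1 + C <= hi2).

(* lra does not use the hypotheses of a section, so they are copied. *)
Ltac barriers := have ? := C_ge0; have ? := lo1_lt0; have ? := hi1_gt0;
  have ? := lo21; have ? := hi12.

Lemma walkS x k : walk x k.+1 = walk x k + x k.
Proof. by rewrite /walk big_ord_recr. Qed.

Lemma state_range x k : (forall j, `|x j| <= C) ->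
  lo2 - C <= (state x k).2 <= hi2 + C.
Proof.
barriers; move=> xC; suff : lo2 - C <= (state x k).2 <= hi2 + C /\
    (~~ (state x k).1 -> (state x k).2 < hi1) by case.
elim: k => [|k [/andP[IH1 IH2] IH3]] /=; first by split => //; apply/andP; split; lra.
have := xC k; rewrite ler_norml => /andP[x1 x2].
rewrite /stopped_step /alive; case: (state x k) IH1 IH2 IH3 => -[] z /= z1 z2 z3.
  by case: ifP => /= [/andP[z4 z5]|_]; split => //; apply/andP; split; lra.
have {}z3 := z3 isT; case: ifP => /= z4.
  by split; [apply/andP; split; lra|rewrite -ltNge].
by split => //; apply/andP; split; lra.
Qed.

Lemma alive_dec x k : alive (state x k.+1) -> alive (state x k).
Proof. by rewrite /= {1}/stopped_step; case: ifP => // ->. Qed.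

(** As long as a phase lasts the stopped walk is the walk itself; the witnesses
    m and N are the times at which the two phases end. *)
Lemma state_spec x k :
  let s := state x k in
  if s.1 then exists m N,
    [/\ (m <= N <= k)%N, forall j, (j <= m)%N -> lo1 < walk x j,
      hi1 <= walk x m, forall j, (j < N)%N -> walk x j < hi2 &
      s.2 = walk x N /\ (alive s -> N = k)]
  else alive s ->
    [/\ forall j, (j <= k)%N -> lo1 < walk x j,
      forall j, (j <= k)%N -> walk x j < hi1 & s.2 = walk x k].
Proof.
barriers; elim: k => [|k] /=.
  by move=> _; rewrite /walk; split => [j|j|]; rewrite ?leqn0 ?big_ord0// => /eqP ->;
    rewrite big_ord0.
rewrite /stopped_step; case: (boolP (alive (state x k))) => [|/negPf] al; last first.
  case: (state x k) al => -[] z //= al; last by rewrite al.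
  move=> [m [N [mNk h1 h2 h3 [h4 h5]]]]; exists m, N; split => //.
    by lia.
  by split => //; rewrite al.
case: (state x k) al => -[] z /= al.
  move=> [m [N [mNk h1 h2 h3 [h4 h5]]]].
  have Nk := h5 isT; rewrite Nk in h4.
  exists m, k.+1; split => //; [by lia| |].
    move=> j; rewrite ltnS leq_eqVlt => /predU1P[->|jk]; last by apply: h3; lia.
    by move: al; rewrite /alive /= h4 => /andP[].
  by rewrite walkS h4.
move=> /(_ isT) [h1 h2 h3]; case: ifPn => [hi|].
  exists k.+1, k.+1; split => //; first by lia.
  - move=> j; rewrite leq_eqVlt ltnS => /predU1P[->|/h1//].
    by rewrite walkS -h3; lra.
  - by rewrite walkS -h3.
  - by move=> j; rewrite ltnS => /h2; lra.
  - by rewrite walkS h3.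
move=> nhi; have hi : z + x k < hi1 by rewrite ltNge.
rewrite /alive /= (negPf nhi) => lo; split.
- by move=> j; rewrite leq_eqVlt ltnS => /predU1P[->|/h1//]; rewrite walkS -h3.
- by move=> j; rewrite leq_eqVlt ltnS => /predU1P[->|/h2//]; rewrite walkS -h3.
- by rewrite walkS h3.
Qed.

Lemma in_valleyP x M : in_valley (state x M) -> has_valley x M.
Proof.
have := state_spec x M; rewrite /in_valley; case: (state x M) => -[] z //=.
move=> [m [N [mN h1 h2 h3 [h4 _]]]] zlo; exists m, N; split => //.
by rewrite -h4.
Qed.

Variables c1 c2 : R.
Hypotheses (c1_ge0 : 0 <= c1) (c2_ge0 : 0 <= c2).
Hypothesis c1_le : c1 * (hi1 - lo1) <= 1.
Hypothesis c2_le : c2 * (hi2 - lo2 + C) <= 1.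
Hypothesis c12 : c1 * (hi1 + C - lo1) <= c2 * (hi2 - hi1 - C).

(** A linear function of the height in each phase, increasing in the first and
    decreasing in the second: it lower-bounds the probability of success. *)
Definition potential s : R :=
  if s.1 then c2 * (hi2 - s.2) else c1 * (s.2 - lo1).

(** The martingale part of the increment of the potential is slope times the
    step of the walk. *)
Definition slope s : R :=
  if alive s then (if s.1 then - c2 else c1) else 0.

Lemma potential_state0 x : potential (state x 0) = c1 * - lo1.
Proof. by rewrite /potential /= sub0r. Qed.

(** When the phase changes, at a height between hi1 and hi1 + C, the potential
    can only jump up: this is what c12 ensures. *)
Lemma potential_move x k : (forall j, `|x j| <= C) ->
  potential (state x k) + slope (state x k) * x k <= potential (state x k.+1).
Proof.
barriers; have ? := c12; move=> xC; rewrite /= /slope /stopped_step; have al := @state_spec x k.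
have := xC k; rewrite ler_norml => /andP[x1 x2].
case: ifP => al'; last by rewrite mul0r addr0.
case: (state x k) al al' => -[] z //= al al'; rewrite /potential /=; first by lra.
have [_ h2 h3] := al al'; have := h2 k (leqnn k); rewrite -h3 => z1.
case: ifP => hi; last by lra.
have : c1 * (z + x k - lo1) <= c1 * (hi1 + C - lo1) by rewrite ler_wpM2l//; lra.
have : c2 * (hi2 - hi1 - C) <= c2 * (hi2 - (z + x k)) by rewrite ler_wpM2l//; lra.
lra.
Qed.

Lemma potential_le x k : (forall j, `|x j| <= C) ->
  potential (state x k) <= (in_valley (state x k))%:R + (alive (state x k))%:R.
Proof.
barriers; move=> xC; have al := @state_spec x k; have := state_range k xC.
case: (state x k) al => -[] z /= al /andP[z1 z2]; rewrite /potential /in_valley /alive /=.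
  have [zlo|zlo] := leP z lo2; rewrite /= ?add0r ?addr0.
    rewrite (le_trans _ c2_le)// ler_wpM2l//; lra.
  have [zhi|zhi] := ltP z hi2.
    rewrite (le_trans _ c2_le)// ler_wpM2l//; lra.
  by rewrite mulr_ge0_le0//; lra.
rewrite add0r; have [zlo|zlo] := ltP lo1 z; last by rewrite mulr_ge0_le0//; lra.
have [_ h2 h3] := al zlo; have := h2 k (leqnn k); rewrite -h3 => z3.
by rewrite (le_trans _ c1_le)// ler_wpM2l//; lra.
Qed.

Lemma pos_move2 x k :
  (state x k.+1).2 ^+ 2 = (state x k).2 ^+ 2 +
    (2 * (alive (state x k))%:R * (state x k).2) * x k +
    (alive (state x k))%:R * x k ^+ 2.
Proof. by rewrite /= /stopped_step; case: ifP => _ /=; ring. Qed.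

End ValleyPath.

(** * Potentials with a deep valley: probability *)

Section ValleyProbability.
Variables (R : realType) (eta : probability (env R) R).
Hypothesis iid : iid_env eta.
Variables (g : R -> R) (C v : R).
Hypotheses (mg : measurable_fun setT g) (gC : forall x, `|g x| <= C).
Hypothesis mean_g : \int[eta]_w g (w 0) = 0.
Hypothesis var_g : \int[eta]_w (g (w 0) ^+ 2) = v.
Variables (lo1 hi1 lo2 hi2 : R).

Definition steps (w : env R) (j : nat) : R := g (w (- j%:Z)).

Let st k w := state lo1 hi1 lo2 hi2 (steps w) k.
Let al k w := alive lo1 lo2 hi2 (st k w).

Let measurable_alive_of k (l : nat) :
  measurable_fun setT ((fun w => (st k w).1) : past R l -> bool) ->
  measurable_fun setT ((fun w => (st k w).2) : past R l -> R) ->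
  measurable_fun setT (al k : past R l -> bool).
Proof.
move=> m1 m2; apply: measurable_fun_ifT => //; last exact: measurable_fun_ltr.
by apply: measurable_and; exact: measurable_fun_ltr.
Qed.

Lemma measurable_state k :
  measurable_fun setT ((fun w => (st k w).1) : past R k -> bool) /\
  measurable_fun setT ((fun w => (st k w).2) : past R k -> R).
Proof.
elim: k => [|k [IH1 IH2]]; first by split; exact: measurable_cst.
have m1 := past_fun_widen IH1; have m2 := past_fun_widen IH2.
have ma := measurable_alive_of m1 m2.
have mx : measurable_fun setT ((fun w => steps w k) : past R k.+1 -> R).
  exact: measurableT_comp mg (@measurable_past_site R k).
have mz : measurable_fun setT ((fun w => (st k w).2 + steps w k) : past R k.+1 -> R).
  exact: measurable_funD.
split.
- rewrite (_ : (fun w => _) = (fun w => if al k w then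
      (st k w).1 || (hi1 <= (st k w).2 + steps w k) else (st k w).1)).
    apply: measurable_fun_ifT => //; apply: measurable_or => //.
    exact: measurable_fun_ler.
  by apply/funext => w; rewrite /st /= /stopped_step -/(al k w); case: ifP.
- rewrite (_ : (fun w => _) = (fun w => if al k w then
      (st k w).2 + steps w k else (st k w).2)).
    exact: measurable_fun_ifT.
  by apply/funext => w; rewrite /st /= /stopped_step -/(al k w); case: ifP.
Qed.

Lemma measurable_alive k : measurable_fun setT (al k : past R k -> bool).
Proof. by have [m1 m2] := measurable_state k; exact: measurable_alive_of. Qed.

Let malE k : measurable_fun setT (al k).
Proof. exact: past_measurable_fun (@measurable_alive k). Qed.

Let m1E k : measurable_fun setT (fun w => (st k w).1).
Proof. by case: (measurable_state k) => m1 _; exact: past_measurable_fun m1. Qed.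

Let m2E k : measurable_fun setT (fun w => (st k w).2).
Proof. by case: (measurable_state k) => _ m2; exact: past_measurable_fun m2. Qed.

Hypotheses (C_ge0 : 0 <= C) (lo1_lt0 : lo1 < 0) (hi1_gt0 : 0 < hi1).
Hypotheses (lo21 : lo2 <= lo1) (hi12 : hi1 + C <= hi2).
Variable L : R.
Hypotheses (L_lo : C - lo2 <= L) (L_hi : hi2 + C <= L).

Let stepsC w j : `|steps w j| <= C. Proof. exact: gC. Qed.

Let posL k w : `|(st k w).2| <= L.
Proof.
have ? := L_lo; have ? := L_hi.
have /andP[? ?] := state_range C_ge0 lo1_lt0 hi1_gt0 lo21 hi12 k (stepsC w).
by rewrite ler_norml; apply/andP; split; rewrite /st; lra.
Qed.

Let bsteps k : bounded_mfun (fun w => steps w k).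
Proof.
split; last by exists C => w.
exact: measurableT_comp mg (@measurable_site R _).
Qed.

Let bal k : bounded_mfun (fun w => (al k w)%:R : R).
Proof. exact: bounded_mfun_indic. Qed.

Let bpos k : bounded_mfun (fun w => (st k w).2).
Proof. by split => //; exists L. Qed.

Let p k := \int[eta]_w (al k w)%:R.

(** The stopped walk is a martingale with orthogonal increments. *)
Lemma second_moment_step k :
  \int[eta]_w ((st k.+1 w).2 ^+ 2) = \int[eta]_w ((st k w).2 ^+ 2) + p k * v.
Proof.
have malp : measurable_fun setT ((fun w => (al k w)%:R : R) : past R k -> R).
  by case: (bounded_mfun_indic R (@measurable_alive k)).
have [_ m2] := measurable_state k.
pose Y w := 2 * (al k w)%:R * (st k w).2.
have mY : measurable_fun setT (Y : past R k -> R).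
  by apply: measurable_funM => //; exact: measurable_funM.
have bY : bounded_mfun Y.
  by apply: bounded_mfunM => //; apply: bounded_mfunM => //; exact: bounded_mfun_cst.
have EY : \int[eta]_w (Y w * steps w k) = 0.
  have [_ [M YM]] := bY.
  by rewrite (past_expectation iid mY YM mg gC) mean_g mulr0.
have mg2 : measurable_fun setT (fun x => g x ^+ 2) by exact: measurable_funX.
have g2C x : `|g x ^+ 2| <= C ^+ 2 by rewrite normrX lerXn2r ?nnegrE.
have Eal : \int[eta]_w ((al k w)%:R * steps w k ^+ 2) = p k * v.
  have al1 w : `|(al k w)%:R : R| <= 1 by case: (al k w); rewrite ?normr1 ?normr0.
  by rewrite (past_expectation iid malp al1 mg2 g2C) var_g.
rewrite -Eal -[X in X + _]addr0 -EY -RintegralD//; last 2 first.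
- by apply: bounded_mfun_integrable; exact: bounded_mfunM.
- by apply: bounded_mfun_integrable; exact: bounded_mfunM.
rewrite -RintegralD//; last 2 first.
- apply: bounded_mfun_integrable; apply: bounded_mfunD; exact: bounded_mfunM.
- by apply: bounded_mfun_integrable; apply: bounded_mfunM => //; exact: bounded_mfunM.
by apply: eq_Rintegral => w _; rewrite [in LHS]/st pos_move2.
Qed.

Lemma second_moment k :
  \int[eta]_w ((st k w).2 ^+ 2) = (\sum_(j < k) p j) * v.
Proof.
elim: k => [|k IH]; last by rewrite second_moment_step IH big_ord_recr /= mulrDl.
rewrite big_ord0 mul0r /Rintegral (eq_integral (cst 0%E)) ?integral0// => w _.
by rewrite /st /= expr0n.
Qed.

Lemma alive_decreasing k : p k.+1 <= p k.
Proof.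
apply: le_Rintegral => //.
- exact: bounded_mfun_integrable.
- exact: bounded_mfun_integrable.
move=> w _; rewrite ler_nat; have := @alive_dec R lo1 hi1 lo2 hi2 (steps w) k.
by rewrite -/(st _ _) -/(al _ _) -/(al _ _); case: (al k.+1 w) => // ->.
Qed.

(** The stopped walk stays bounded by L, so its second moment bounds the
    expected number of steps made before it is stopped. *)
Lemma alive_prob_le k : k%:R * p k * v <= L ^+ 2.
Proof.
have v_ge0 : 0 <= v by rewrite -var_g; apply: Rintegral_ge0 => w _; exact: sqr_ge0.
have pk_le : k%:R * p k <= \sum_(j < k) p j.
  have -> : k%:R * p k = \sum_(j < k) p k by rewrite sumr_const card_ord mulr_natl.
  apply: ler_sum => j _; have := ltnW (ltn_ord j).
  apply: (@homo_leq _ _ (fun a b => b <= a)) => [//|a b c ab bc|i].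
    exact: le_trans bc ab.
  exact: alive_decreasing.
apply: le_trans (ler_wpM2r v_ge0 pk_le) _; rewrite -second_moment.
have -> : L ^+ 2 = \int[eta]_w (L ^+ 2).
  by rewrite mean_cst.
apply: le_Rintegral => //.
- by apply: bounded_mfun_integrable; exact: bounded_mfunM.
- by apply: bounded_mfun_integrable; exact: bounded_mfun_cst.
move=> w _; rewrite -[leLHS]ger0_norm ?sqr_ge0// normrX lerXn2r ?nnegrE//.
exact: le_trans (posL k w).
Qed.

Variables c1 c2 : R.
Hypotheses (c1_ge0 : 0 <= c1) (c2_ge0 : 0 <= c2).
Hypothesis c1_le : c1 * (hi1 - lo1) <= 1.
Hypothesis c2_le : c2 * (hi2 - lo2 + C) <= 1.
Hypothesis c12 : c1 * (hi1 + C - lo1) <= c2 * (hi2 - hi1 - C).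

Let W k w := potential lo1 hi2 c1 c2 (st k w).
Let sl k w := slope lo1 lo2 hi2 c1 c2 (st k w).

Lemma bounded_potential k : bounded_mfun (W k).
Proof.
split.
  apply: measurable_fun_ifT => //.
    by apply: measurable_funM => //; exact: measurable_funB.
  by apply: measurable_funM => //; exact: measurable_funB.
exists (c2 * (`|hi2| + L) + c1 * (L + `|lo1|)) => w.
have L_ge0 : 0 <= L by exact: le_trans (posL k w).
rewrite /W /potential; case: ifP => _; rewrite normrM ger0_norm//.
  rewrite -[leLHS]addr0 lerD// ?mulr_ge0 ?addr_ge0// ler_wpM2l//.
  by rewrite (le_trans (ler_normB _ _))// lerD// posL.
rewrite -[leLHS]add0r lerD// ?mulr_ge0 ?addr_ge0// ler_wpM2l//.
by rewrite (le_trans (ler_normB _ _))// lerD// posL.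
Qed.

(** Submartingale property; the martingale part has mean zero because the slope
    depends on the past only. *)
Lemma potential_increases k : \int[eta]_w W k w <= \int[eta]_w W k.+1 w.
Proof.
have [m1 m2] := measurable_state k; have ma := @measurable_alive k.
have msl : measurable_fun setT (sl k : past R k -> R).
  by apply: measurable_fun_ifT => //; exact: measurable_fun_ifT.
have bsl w : `|sl k w| <= c1 + c2.
  rewrite /sl /slope; case: ifP => _; last by rewrite normr0 addr_ge0.
  by case: ifP => _; rewrite ?normrN ger0_norm// ?lerDl ?lerDr.
have Esl : \int[eta]_w (sl k w * steps w k) = 0.
  by rewrite (past_expectation iid msl bsl mg gC) mean_g mulr0.
have bsl' : bounded_mfun (sl k).
  by split; [exact: past_measurable_fun msl|exists (c1 + c2)].
rewrite -[leLHS]addr0 -Esl -RintegralD//; last 2 first.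
- by apply: bounded_mfun_integrable; exact: bounded_potential.
- by apply: bounded_mfun_integrable; exact: bounded_mfunM.
apply: le_Rintegral => //.
- apply: bounded_mfun_integrable; apply: bounded_mfunD; first exact: bounded_potential.
  exact: bounded_mfunM.
- by apply: bounded_mfun_integrable; exact: bounded_potential.
move=> w _.
exact: (potential_move C_ge0 lo1_lt0 hi1_gt0 lo21 hi12 c1_ge0 c2_ge0 c12 k (stepsC w)).
Qed.

Lemma valley_probability_ge M :
  c1 * - lo1 - p M <= fine (eta [set w | in_valley lo2 (st M w)]).
Proof.
have mv : measurable_fun setT (fun w => in_valley lo2 (st M w)).
  by apply: measurable_and => //; exact: measurable_fun_ler.
have bv : bounded_mfun (fun w => (in_valley lo2 (st M w))%:R : R).
  exact: bounded_mfun_indic.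
rewrite -mean_indic// lerBlDr -RintegralD//; last 2 first.
- exact: bounded_mfun_integrable.
- exact: bounded_mfun_integrable.
have WM : c1 * - lo1 <= \int[eta]_w W M w.
  elim: M {mv bv} => [|M IH]; last exact: le_trans IH (potential_increases M).
  rewrite -[leLHS](mean_cst eta).
  rewrite le_eqVlt; apply/orP; left; apply/eqP.
  by apply: eq_Rintegral => w _; rewrite /W /st potential_state0.
apply: le_trans WM _; apply: le_Rintegral => //.
- by apply: bounded_mfun_integrable; exact: bounded_potential.
- by apply: bounded_mfun_integrable; exact: bounded_mfunD.
move=> w _.
exact: (potential_le C_ge0 lo1_lt0 hi1_gt0 lo21 hi12 c1_ge0 c2_ge0 c1_le c2_le M (stepsC w)).
Qed.

End ValleyProbability.

(** * Log-odds of an elliptic environment *)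

Section Environment.
Variables (R : realType) (eta : probability (env R) R) (eps0 : R).
Hypothesis iid : iid_env eta.
Hypothesis eps0_gt0 : 0 < eps0.
Hypothesis elliptic0 : eta [set w | eps0 <= w 0%R <= 1 - eps0] = 1%E.

Definition log_odds (x : R) : R := ln ((1 - x) / x).

Definition elliptic (x : R) : bool := eps0 <= x <= 1 - eps0.

(** Truncated so as to be bounded everywhere; for almost every environment the
    truncation has no effect. *)
Definition elliptic_log_odds (x : R) : R := if elliptic x then log_odds x else 0.

Lemma measurable_log_odds : measurable_fun setT log_odds.
Proof.
rewrite (_ : log_odds = fun x => if (0 < x) && (x < 1) then ln (1 - x) - ln x else 0).
  apply: measurable_fun_ifT => //.
    by apply: measurable_and; exact: measurable_fun_ltr.
  apply: measurable_funB; last exact: measurable_ln.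
  by apply: (measurableT_comp (@measurable_ln R)); exact: measurable_funB.
apply/funext => x; rewrite /log_odds; case: ifPn => [/andP[x0 x1]|x01].
  by rewrite lnM ?posrE ?invr_gt0 ?subr_gt0// lnV ?posrE.
rewrite ln0//; move: x01; rewrite negb_and -!leNgt => /orP[x0|x1].
  by rewrite mulr_ge0_le0 ?invr_le0//; lra.
by rewrite mulr_le0_ge0 ?invr_ge0//; lra.
Qed.

Lemma measurable_elliptic : measurable_fun setT elliptic.
Proof. by apply: measurable_and; exact: measurable_fun_ler. Qed.

Lemma measurable_elliptic_log_odds : measurable_fun setT elliptic_log_odds.
Proof.
apply: measurable_fun_ifT => //; first exact: measurable_elliptic.
exact: measurable_log_odds.
Qed.

Lemma measurable_elliptic_set : measurable [set x | elliptic x].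
Proof.
by rewrite -[X in measurable X]setTI; exact: measurable_elliptic measurableT [set true] _.
Qed.

Lemma elliptic_gt0 x : elliptic x -> 0 < x < 1.
Proof. by have := eps0_gt0; rewrite /elliptic => ? /andP[? ?]; apply/andP; split; lra. Qed.

Lemma eps0_lt1 : eps0 < 1.
Proof.
rewrite ltNge; apply/negP => eps1; suff : (1 = 0 :> \bar R)%E by move/eqP; rewrite onee_eq0.
rewrite -elliptic0 (_ : [set w | _] = set0) ?measure0//.
by apply/seteqP; split => // w /= /andP[? ?]; have := eps0_gt0; lra.
Qed.

Lemma ln_eps0_le0 : ln eps0 <= 0.
Proof. by rewrite ln_le0// ltW// eps0_lt1. Qed.

Lemma elliptic_log_odds_bounded x : `|elliptic_log_odds x| <= - ln eps0.
Proof.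
rewrite /elliptic_log_odds; case: ifPn => [ex|_]; last first.
  by rewrite normr0 oppr_ge0 ln_eps0_le0.
have /andP[x0 x1] := elliptic_gt0 ex; have e0 := eps0_gt0.
have e1 := eps0_lt1; move/andP: ex => [ex1 ex2].
rewrite /log_odds lnM ?posrE ?invr_gt0 ?subr_gt0// lnV ?posrE//.
have l1 : ln eps0 <= ln x by rewrite ler_ln ?posrE.
have l2 : ln eps0 <= ln (1 - x) by rewrite ler_ln ?posrE ?subr_gt0//; lra.
have l3 : ln x <= 0 by rewrite ln_le0// ltW.
have l4 : ln (1 - x) <= 0 by rewrite ln_le0//; lra.
by rewrite ler_norml; apply/andP; split; lra.
Qed.

Definition all_elliptic : set (env R) := [set w | forall i, elliptic (w i)].

Let site_elliptic (i : int) : set (env R) := [set w | elliptic (w i)].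

Let measurable_site_elliptic i : measurable (site_elliptic i).
Proof. exact: (measurable_site_preim i measurable_elliptic_set). Qed.

Let all_ellipticE :
  all_elliptic = \bigcap_n (site_elliptic n%:Z `&` site_elliptic (Negz n)).
Proof.
apply/seteqP; split => w h; first by move=> n _; split; exact: h.
by case=> n; have [] := h n I.
Qed.

Lemma measurable_all_elliptic : measurable all_elliptic.
Proof.
by rewrite all_ellipticE; apply: bigcapT_measurable => n; exact: measurableI.
Qed.

Lemma all_elliptic_full : eta (~` all_elliptic) = 0%E.
Proof.
have site0 i : eta.-negligible (~` site_elliptic i).
  apply/negligibleP; first exact: measurableC.
  have site1 : eta (site_elliptic i) = 1%E.
    by rewrite -elliptic0; exact: (site_law iid i measurable_elliptic_set).
  have siteC : eta (~` site_elliptic i) = 0%E.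
    by rewrite probability_setC// [X in (_ - X)%E]site1 subee.
  exact: siteC.
apply/negligibleP; first by apply: measurableC; exact: measurable_all_elliptic.
rewrite all_ellipticE setC_bigcap; apply: negligible_bigcup => n.
by rewrite setCI; exact: negligibleU.
Qed.

Lemma mean_elliptic (h : R -> R) : measurable_fun setT h ->
  (\int[eta]_w (h (log_odds (w 0%R)))%:E =
   \int[eta]_w (h (elliptic_log_odds (w 0%R)))%:E)%E.
Proof.
move=> mh; apply: ae_eq_integral => //.
- apply/measurable_EFinP; apply: measurableT_comp => //.
  exact: measurableT_comp measurable_log_odds (@measurable_site R 0).
- apply/measurable_EFinP; apply: measurableT_comp => //.
  exact: measurableT_comp measurable_elliptic_log_odds (@measurable_site R 0).
- exists (~` all_elliptic); split.
  + by apply: measurableC; exact: measurable_all_elliptic.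
  + exact: all_elliptic_full.
  + by apply: subsetC => w ew /= _; rewrite /elliptic_log_odds ew.
Qed.

Hypothesis centered : ('E_eta[fun w => ln (rho 0 w)] = 0)%E.
Hypothesis nondegenerate : (0 < 'V_eta[fun w => ln (rho 0 w)])%E.

Lemma mean_elliptic_log_odds : \int[eta]_w elliptic_log_odds (w 0) = 0.
Proof.
rewrite /Rintegral -(mean_elliptic (h := id))//; have := centered.
by rewrite unlock /log_odds -/(rho 0 _) => ->.
Qed.

Lemma variance_elliptic_log_odds : 0 < \int[eta]_w (elliptic_log_odds (w 0) ^+ 2).
Proof.
have bg : bounded_mfun (fun w : env R => elliptic_log_odds (w 0)).
  split; last by exists (- ln eps0) => w; exact: elliptic_log_odds_bounded.
  exact: measurableT_comp measurable_elliptic_log_odds (@measurable_site R 0).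
rewrite -lte_fin /Rintegral fineK; last first.
  apply: integrable_fin_num => //.
  exact: (bounded_mfun_integrable eta (bounded_mfunM bg bg)).
rewrite -(mean_elliptic (h := fun x => x ^+ 2)); last exact: measurable_funX.
have := nondegenerate; rewrite /variance unlock centered /= unlock => V0.
apply: lt_le_trans V0 _; rewrite le_eqVlt; apply/orP; left; apply/eqP.
by apply: eq_integral => w _; rewrite !fctE /= !subr0 expr2.
Qed.

End Environment.

(** * Environments that trap the walk for a prescribed time *)

Section ValleyEnvironment.
Variables (R : realType) (eta : probability (env R) R) (eps0 : R).
Hypothesis iid : iid_env eta.
Hypothesis eps0_gt0 : 0 < eps0.
Hypothesis elliptic0 : eta [set w | eps0 <= w 0%R <= 1 - eps0] = 1%E.
Hypothesis centered : ('E_eta[fun w => ln (rho 0 w)] = 0)%E.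

(** At the scale l = log (1/r): the trap has depth about (1 - 4 d) l, is entered
    with probability at least about exp (- d l), and is closed on the far side
    by a wall that is passed with probability at most exp (- 2 d l). *)
Definition deep_valley (d l : R) (M : nat) (w : env R) : Prop :=
  has_valley (- (d * l)) ((1 - 4 * d) * l) (- (2 * d * l)) ((1 - 2 * d) * l)
    (steps (elliptic_log_odds eps0) w) M.

(** No exponential cost: this is gambler's ruin at scale l, run for at least a
    large multiple of l ^ 2 steps. The potential starts at c1 (d l) = d ^ 2 / 2, and
    M is so large that the walk is still alive with probability at most
    d ^ 2 / 4. *)
Lemma deep_valley_probability (d l : R) (M : nat) :
  0 < d -> d <= 8^-1 -> 0 < l -> - ln eps0 <= d * l ->
  4 * l ^+ 2 <= d ^+ 2 * \int[eta]_w (elliptic_log_odds eps0 (w 0) ^+ 2) * M%:R ->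
  exists2 A : set (env R), measurable A &
    ((d ^+ 2 / 4)%:E <= eta A)%E /\
    forall w, A w -> all_elliptic eps0 w /\ deep_valley d l M w.
Proof.
move=> d_gt0 d_le l_gt0 Cdl; set v := \int[eta]_w _ => Mge.
pose C := - ln eps0; rewrite -/C in Cdl; pose g := elliptic_log_odds eps0.
have C_ge0 : 0 <= C by rewrite oppr_ge0 (ln_eps0_le0 eps0_gt0 elliptic0).
have gC x : `|g x| <= C by exact: (elliptic_log_odds_bounded eps0_gt0 elliptic0).
have mg : measurable_fun setT g by exact: measurable_elliptic_log_odds.
have mean_g : \int[eta]_w g (w 0) = 0 by exact: (mean_elliptic_log_odds iid elliptic0 centered).
have dl : 0 < d * l by rewrite mulr_gt0.
have dl8 : d * l <= 8^-1 * l by rewrite ler_wpM2r// ltW.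
have b1 : - (d * l) < 0 by lra.
have b2 : 0 < (1 - 4 * d) * l by lra.
have b3 : - (2 * d * l) <= - (d * l) by lra.
have b4 : (1 - 4 * d) * l + C <= (1 - 2 * d) * l by lra.
have L1 : C - - (2 * d * l) <= l by lra.
have L2 : (1 - 2 * d) * l + C <= l by lra.
(* c2 normalizes the second-phase potential to be at most 1 on an interval of
   length about l; c1 is then the largest slope, up to constants, that makes the
   potential jump up at the change of phase. *)
pose c1 := d / (2 * l); pose c2 := (2 * l)^-1.
have c2l : c2 * l = 2^-1 by rewrite /c2; field; rewrite gt_eqF.
have c1l : c1 * l = d / 2 by rewrite /c1; field; rewrite gt_eqF.
have c2_ge0 : 0 <= c2 by rewrite invr_ge0; lra.
have c1_ge0 : 0 <= c1 by rewrite mulr_ge0// ltW.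
have h1 : c1 * ((1 - 4 * d) * l - - (d * l)) <= 1.
  have : c1 * ((1 - 4 * d) * l - - (d * l)) <= c1 * l by rewrite ler_wpM2l//; lra.
  lra.
have h2 : c2 * ((1 - 2 * d) * l - - (2 * d * l) + C) <= 1.
  have : c2 * ((1 - 2 * d) * l - - (2 * d * l) + C) <= c2 * (2 * l).
    by rewrite ler_wpM2l//; lra.
  lra.
have h3 : c1 * ((1 - 4 * d) * l + C - - (d * l)) <=
    c2 * ((1 - 2 * d) * l - (1 - 4 * d) * l - C).
  have : c1 * ((1 - 4 * d) * l + C - - (d * l)) <= c1 * l by rewrite ler_wpM2l//; lra.
  have : c2 * (d * l) <= c2 * ((1 - 2 * d) * l - (1 - 4 * d) * l - C).
    by rewrite ler_wpM2l//; lra.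
  have c2dl : c2 * (d * l) = d / 2 by rewrite mulrCA c2l.
  lra.
pose st M w := state (- (d * l)) ((1 - 4 * d) * l) (- (2 * d * l)) ((1 - 2 * d) * l)
  (steps g w) M.
pose V := [set w : env R | in_valley (- (2 * d * l)) (st M w)].
have := alive_prob_le iid mg gC mean_g (erefl v) C_ge0 b1 b2 b3 b4 L1 L2 M.
have := valley_probability_ge iid mg gC mean_g C_ge0 b1 b2 b3 b4 L1 L2
  c1_ge0 c2_ge0 h1 h2 h3 M.
set p := \int[eta]_w _ => VP pM.
have VP' : d ^+ 2 / 4 <= fine (eta V).
  have c1dl : c1 * (d * l) = d ^+ 2 / 2 by rewrite mulrCA c1l; field.
  have l2 : 0 < l ^+ 2 by rewrite exprn_gt0.
  have vM : 0 < v * M%:R.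
    have : 0 < d ^+ 2 * v * M%:R by apply: lt_le_trans Mge; rewrite mulr_gt0.
    by rewrite -mulrA => h; rewrite -(pmulr_rgt0 _ (exprn_gt0 2 d_gt0)).
  have : p <= d ^+ 2 / 4 by rewrite -(ler_pM2r vM); lra.
  move: VP; rewrite opprK c1dl; rewrite -/V; lra.
have mV : measurable V.
  have [m1 m2] := measurable_state mg (- (d * l)) ((1 - 4 * d) * l)
    (- (2 * d * l)) ((1 - 2 * d) * l) M.
  have mv : measurable_fun setT (fun w => in_valley (- (2 * d * l)) (st M w)).
    apply: measurable_and; first exact: past_measurable_fun m1.
    by apply: measurable_fun_ler => //; exact: past_measurable_fun m2.
  by rewrite -[V]setTI; exact: mv measurableT [set true] _.
exists (V `&` all_elliptic eps0).
  by apply: measurableI => //; exact: measurable_all_elliptic.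
split=> [|w [Vw ew]]; last first.
  by split => //; exact: (in_valleyP C_ge0 b1 b2 b3 b4 Vw).
have -> : eta (V `&` all_elliptic eps0) = eta V.
  have mell : measurable (all_elliptic eps0 : set (env R)).
    exact: measurable_all_elliptic.
  have -> : (eta V = eta (V `\` all_elliptic eps0) + eta (V `&` all_elliptic eps0))%E.
    exact: measureDI.
  rewrite [X in (X + _)%E](_ : _ = 0%E) ?add0e//.
  apply: (@subset_measure0 _ _ _ _ _ (~` all_elliptic eps0)).
  - exact: measurableD.
  - exact: measurableC.
  - by move=> w [].
  - exact: (all_elliptic_full iid elliptic0).
by rewrite -[eta V]fineK ?lee_fin// fin_num_measure.
Qed.
End ValleyEnvironment.

Section QuenchedWindow.
Variables (R : realType) (eps0 d l : R) (w : env R) (M n1 n2 : nat).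
Hypothesis eps0_gt0 : 0 < eps0.
Hypothesis ew : all_elliptic eps0 w.
Hypothesis valley : deep_valley eps0 d l M w.

Let y (i : nat) : R := w (- i%:Z).

(** The lower bound for n1 uses the top of the potential, at m, and the upper
    bound for n2 the far wall, at N. The first is at least exp (- d l) and the
    second at most exp (- 2 d l), up to factors polynomial in M which the last
    hypothesis absorbs. *)
Lemma quenched_window :
  (0 < n2)%N -> n1%:R <= expR ((1 - 6 * d) * l) ->
  expR l / 2 <= n2%:R ->
  M.+1%:R * (3 + 2 * M%:R / eps0) <= expR (d * l) ->
  expR (- (2 * d * l)) <= surv y n1 1 - surv y n2 1.
Proof.
move=> n2_gt0 n1_le n2_ge X_ge.
pose S := walk (steps (elliptic_log_odds eps0) w); pose E k := expR (S k).
have y_gt0 j : 0 < y j by have /andP[] := elliptic_gt0 eps0_gt0 (ew (- j%:Z)).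
have y_lt1 j : y j < 1 by have /andP[] := elliptic_gt0 eps0_gt0 (ew (- j%:Z)).
have y01 j : 0 <= y j <= 1 by rewrite !ltW.
have E_gt0 k : 0 < E k by exact: expR_gt0.
have E0 : E 0 = 1 by rewrite /E /S /walk big_ord0 expR0.
have yE i : y i * E i.+1 = (1 - y i) * E i.
  rewrite /E /S walkS expRD /steps /elliptic_log_odds ew /log_odds -/(y i).
  rewrite lnK ?posrE ?divr_gt0 ?subr_gt0//.
  by rewrite mulrCA [y i * _]mulrCA divff ?mulr1 1?mulrC// gt_eqF.
have [m [N [/andP[mN NM] h1 h2 h3 h4]]] := valley.
set X := expR (d * l) in X_ge *.
have X_gt0 : 0 < X by exact: expR_gt0.
have X2 : expR (- (2 * d * l)) = (X ^+ 2)^-1.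
  by rewrite expRN /X -expRM_natl mulrA.
have m_le : (m <= M)%N by exact: leq_trans NM.
have low : (M.+1%:R * X)^-1 - (X ^+ 2)^-1 <= surv y n1 1.
  apply: le_trans (surv1_ge y01 E_gt0 E0 yE m n1).
  have scale_gt0 : 0 < scale E m.+1 by exact: lt_le_trans (scaleS_ge1 E_gt0 E0 m).
  rewrite lerB//.
    rewrite lef_pV2 ?posrE// ?mulr_gt0//.
    apply: (@le_trans _ _ (\sum_(k < m.+1) X)).
      apply: ler_sum => k _; rewrite -[leRHS]invrK lef_pV2 ?posrE ?invr_gt0//.
      rewrite -expRN ler_expR ltW// h1//.
      by have := ltn_ord k.
    by rewrite sumr_const card_ord -[leLHS]mulr_natl ler_wpM2r ?(ltW X_gt0)// ler_nat.
  rewrite ler_pdivrMr// -X2 (le_trans n1_le)//.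
  rewrite (_ : (1 - 6 * d) * l = - (2 * d * l) + (1 - 4 * d) * l); last by lra.
  by rewrite expRD ler_wpM2l ?expR_ge0// ler_expR.
have up : surv y n2 1 <= (X ^+ 2)^-1 + 2 * M%:R / eps0 * (X ^+ 2)^-1.
  apply: le_trans (surv1_le y01 E_gt0 E0 yE N y_gt0 n2_gt0) _.
  rewrite lerD//; first by rewrite -X2 ler_expR.
  rewrite ler_pdivrMr ?ltr0n//.
  apply: (@le_trans _ _ (\sum_(k < N) (expR ((1 - 2 * d) * l) / eps0))).
    apply: ler_sum => k _; rewrite ler_pM ?invr_ge0 ?expR_ge0 ?(ltW (y_gt0 _))//.
      by rewrite ler_expR ltW// h3.
    by rewrite lef_pV2 ?posrE//; case/andP: (ew (- k%:Z)).
  rewrite sumr_const card_ord -[leLHS]mulr_natl.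
  have -> : expR ((1 - 2 * d) * l) = expR l * (X ^+ 2)^-1.
    by rewrite -X2 -expRD; congr expR; lra.
  have e_ge0 : 0 <= eps0^-1 * (X ^+ 2)^-1.
    by rewrite mulr_ge0// invr_ge0 ?exprn_ge0// ltW.
  have -> : N%:R * (expR l * (X ^+ 2)^-1 / eps0) =
      N%:R * (eps0^-1 * (X ^+ 2)^-1) * (expR l / 2) * 2 by field; rewrite !gt_eqF.
  have -> : 2 * M%:R / eps0 * (X ^+ 2)^-1 * n2%:R =
      M%:R * (eps0^-1 * (X ^+ 2)^-1) * n2%:R * 2 by field; rewrite !gt_eqF.
  rewrite ler_wpM2r//; apply: ler_pM => //.
  - exact: mulr_ge0.
  - by rewrite ler_wpM2r// ler_nat.
have key : (X ^+ 2)^-1 * (3 + 2 * M%:R / eps0) <= (M.+1%:R * X)^-1.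
  rewrite -(ler_pM2l (_ : 0 < M.+1%:R * X ^+ 2)) ?mulr_gt0 ?exprn_gt0//.
  rewrite [leRHS](_ : _ = X); last by field; rewrite !gt_eqF.
  by rewrite mulrA mulfK ?gt_eqF ?exprn_gt0.
rewrite X2; move: key low up; set a := (X ^+ 2)^-1; set b := 2 * _ / _.
by set c := (_ * X)^-1; nra.
Qed.
End QuenchedWindow.

(** * From the window probability to the moment *)

Section HittingTime.
Variables (R : realType).
Implicit Type s : traj.

Lemma tau_first_hit (a : int) s k : (0 < k)%N -> s k = a ->
  exists2 j, (0 < j <= k)%N & s j = a /\ tau R a s = j%:R%:E.
Proof.
move=> k0 sk; have ex : exists j, (0 < j)%N && (s j == a).
  by exists k; rewrite k0 sk eqxx.
case: (ex_minnP ex) => j /andP[j0 /eqP sj] minj.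
exists j; first by rewrite j0 minj// k0 sk eqxx.
split => //; apply/eqP; rewrite eq_le; apply/andP; split.
  by apply: ereal_inf_lbound; exists j.
apply: le_ereal_inf_tmp => _ [i [i0 si] <-].
by rewrite lee_fin ler_nat minj// i0 si eqxx.
Qed.

Lemma tau_cases (a : int) s :
  tau R a s = +oo%E \/ exists2 j, (0 < j)%N & tau R a s = j%:R%:E.
Proof.
have [[k [k0 sk]]|nohit] := pselect (exists k, (0 < k)%N /\ s k = a).
  by right; have [j /andP[j0 _] [_ tj]] := tau_first_hit k0 sk; exists j.
left; have -> : tau R a s = ereal_inf set0; last exact: ereal_inf0.
rewrite /tau; congr ereal_inf; apply/seteqP; split => // x [n [n0 sn] _].
by apply: nohit; exists n.
Qed.

Lemma tau_window (a : int) s n1 n2 :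
  (avoids a 0 n1 `\` avoids a 0 n2) s ->
  exists2 k, (n1 < k <= n2)%N & tau R a s = k%:R%:E.
Proof.
move=> [av1 av2]; have [k [k0 kn2 sk]] : exists k, [/\ (0 < k)%N, (k <= n2)%N & s k = a].
  apply: contrapT => h; apply: av2 => j /andP[j0 jn] sj; apply: h.
  by exists j; split.
have [j /andP[j0 jk] [sj tj]] := tau_first_hit k0 sk.
exists j => //; rewrite (leq_trans jk kn2) andbT ltnNge; apply/negP => jn1.
by apply: (av1 j); rewrite ?j0.
Qed.

(** From u / alpha <= exp (u / alpha), raised to the power alpha. *)
Lemma powR_mul_expR_le (alpha u : R) : 0 < alpha -> 0 <= u ->
  u `^ alpha * expR (- u) <= alpha `^ alpha.
Proof.
move=> a0 u0; rewrite expRN ler_pdivrMr ?expR_gt0//.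
have -> : expR u = (expR (u / alpha)) `^ alpha.
  by rewrite -expRM divfK// gt_eqF.
rewrite -powRM ?expR_ge0 ?(ltW a0)//.
rewrite ge0_ler_powR ?(ltW a0) ?nnegrE ?mulr_ge0 ?expR_ge0 ?(ltW a0)//.
rewrite mulrC -ler_pdivrMr// (le_trans _ (expR_ge1Dx _))//.
by rewrite lerDr.
Qed.

Definition tilted (alpha r : R) s : \bar R :=
  (tau R 1 s `^ alpha * expeR (- (r%:E * tau R 1 s)))%E.

Lemma tiltedE (alpha r : R) s (k : nat) : tau R 1 s = k%:R%:E ->
  tilted alpha r s = (k%:R `^ alpha * expR (- (r * k%:R)))%:E.
Proof. by move=> tk; rewrite /tilted tk. Qed.

Lemma tilted_ge0 (alpha r : R) s : (0 <= tilted alpha r s)%E.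
Proof. by rewrite /tilted mule_ge0 ?poweR_ge0 ?expeR_ge0. Qed.

(** A path that never hits 1 contributes +oo * 0 = 0. *)
Lemma tilted_le (alpha r : R) s : 0 < alpha -> 0 < r ->
  (tilted alpha r s <= (alpha `^ alpha * r^-1 `^ alpha)%:E)%E.
Proof.
move=> a0 r0; have [ty|[k k0 tk]] := tau_cases 1 s.
  rewrite /tilted ty gt0_muley ?lte_fin//= mule0.
  by rewrite lee_fin mulr_ge0 ?powR_ge0.
rewrite (tiltedE _ _ tk) lee_fin.
have -> : k%:R `^ alpha = (r * k%:R) `^ alpha * r^-1 `^ alpha.
  rewrite -powRM ?mulr_ge0 ?invr_ge0 ?(ltW r0)//.
  by rewrite mulrAC divff ?mul1r// gt_eqF.
rewrite mulrAC ler_wpM2r ?powR_ge0//.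
by apply: powR_mul_expR_le => //; rewrite mulr_ge0// ltW.
Qed.

End HittingTime.

Section AnnealedBounds.

(** Immediate from the definition of the integral as a supremum over simple
    functions; in this form it spares the measurability of the hitting time. *)
Lemma ge0_integral_homo d (T : measurableType d) (R : realType)
    (mu : {measure set T -> \bar R}) (f g : T -> \bar R) :
  (forall x, 0 <= f x)%E -> (forall x, f x <= g x)%E ->
  (\int[mu]_x f x <= \int[mu]_x g x)%E.
Proof.
move=> f0 fg; have g0 x : (0 <= g x)%E by exact: le_trans (fg x).
rewrite !ge0_integralTE//; apply: ereal_sup_le => _ [h hf <-].
by exists h => // x; exact: le_trans (fg x).
Qed.

Lemma ge0_integral_ge_measure d (T : measurableType d) (R : realType)
    (mu : {measure set T -> \bar R}) (f : T -> \bar R) (A : set T) (c : R) :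
  measurable A -> 0 <= c -> (forall x, 0 <= f x)%E ->
  (forall x, A x -> c%:E <= f x)%E -> (c%:E * mu A <= \int[mu]_x f x)%E.
Proof.
move=> mA c0 f0 cf; rewrite -integral_cst// integral_mkcond.
apply: ge0_integral_homo => x.
  by rewrite patchE; case: ifP; rewrite ?lee_fin.
by rewrite patchE; case: ifPn; rewrite ?inE => // /cf.
Qed.

Variables (R : realType) (eta : probability (env R) R) (P : R.-pker (env R) ~> traj).
Variable alpha : R.
Hypothesis alpha_gt0 : 0 < alpha.
Hypothesis quenched : quenched_family P.

Definition tilted_moment (r : R) : \bar R :=
  (\int[annealed eta P]_s (tilted alpha r s))%E.

Lemma tilted_moment_le r : 0 < r ->
  (tilted_moment r <= (alpha `^ alpha * r^-1 `^ alpha)%:E)%E.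
Proof.
move=> r0; pose c : \bar R := (alpha `^ alpha * r^-1 `^ alpha)%:E.
apply: (@le_trans _ _ (\int[annealed eta P]_s (cst c s))%E).
  by apply: ge0_integral_homo => s; [exact: tilted_ge0|exact: tilted_le].
rewrite integral_cst//.
have aT : annealed eta P setT = 1%E by exact: probability_setT.
by rewrite [X in (_ * X)%E]aT mule1.
Qed.

Lemma annealed_window_ge (A : set (env R)) (q : R) n1 n2 :
  measurable A -> 0 <= q ->
  (forall w, A w -> (forall i, 0 <= w i <= 1) /\
    q <= surv (fun i => w (- i%:Z)) n1 1 - surv (fun i => w (- i%:Z)) n2 1) ->
  (q%:E * eta A <= annealed eta P (avoids 1 0 n1 `\` avoids 1 0 n2))%E.
Proof.
move=> mA q0 Aq; rewrite /annealed.
have m1 := measurable_avoids 1 0 n1; have m2 := measurable_avoids 1 0 n2.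
apply: ge0_integral_ge_measure => // w Aw.
have [w01 q_le] := Aq w Aw.
have PwT : P w setT = 1%E by exact: prob_kernel.
have PwE n : P w (avoids 1 0 n) = (surv (fun i => w (- i%:Z)) n 1)%:E.
  exact: (quenched_survival w01 PwT (quenched w01)).
have fin1 : (P w (avoids 1 0 n1) < +oo)%E by rewrite PwE ltry.
have -> : (P w (avoids 1 0 n1 `\` avoids 1 0 n2) =
    P w (avoids 1 0 n1) - P w (avoids 1 0 n1 `&` avoids 1 0 n2))%E.
  exact: measureD.
apply: (@le_trans _ _ (P w (avoids 1 0 n1) - P w (avoids 1 0 n2))%E).
  by rewrite !PwE -EFinB lee_fin.
apply: leeB => //; apply: le_measure; rewrite ?inE//.
exact: measurableI.
Qed.

(** Only the paths that hit 1 at a time between n1 + 1 and n2 are kept, and only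
    the environments in A. *)
Lemma tilted_moment_ge (A : set (env R)) (q p0 z r : R) n1 n2 :
  measurable A -> 0 <= q -> 0 <= z -> 0 < r ->
  (forall w, A w -> (forall i, 0 <= w i <= 1) /\
    q <= surv (fun i => w (- i%:Z)) n1 1 - surv (fun i => w (- i%:Z)) n2 1) ->
  (p0%:E <= eta A)%E -> z <= n1.+1%:R -> r * n2%:R <= 1 ->
  ((z `^ alpha * expR (- 1) * (q * p0))%:E <= tilted_moment r)%E.
Proof.
move=> mA q0 z0 r0 Aq p0A zn1 rn2.
have m1 := measurable_avoids 1 0 n1; have m2 := measurable_avoids 1 0 n2.
pose B := avoids 1 0 n1 `\` avoids 1 0 n2.
have mB : measurable B by exact: measurableD.
have c0 : 0 <= z `^ alpha * expR (- 1) by rewrite mulr_ge0 ?powR_ge0 ?expR_ge0.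
apply: (@le_trans _ _ ((z `^ alpha * expR (- 1))%:E * annealed eta P B)%E).
  rewrite EFinM; apply: lee_wpmul2l; first by rewrite lee_fin.
  apply: le_trans (annealed_window_ge mA q0 Aq).
  by rewrite EFinM; apply: lee_wpmul2l.
apply: ge0_integral_ge_measure => // [s|s Bs]; first exact: tilted_ge0.
have [k /andP[n1k kn2] tk] := tau_window R Bs.
rewrite (tiltedE _ _ tk) lee_fin ler_pM ?powR_ge0 ?expR_ge0//.
  rewrite ge0_ler_powR ?nnegrE// ?(ltW alpha_gt0)//.
  by rewrite (le_trans zn1)// ler_nat.
rewrite ler_expR lerN2 (le_trans _ rn2)// ler_wpM2l ?ler_nat//.
exact: ltW.
Qed.

End AnnealedBounds.

(** * The logarithmic asymptotics *)

(** Since expR (d l) is at least (d l / 5) ^ 5, it beats the degree-four polynomial on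
    the left as soon as l exceeds a constant. *)
Lemma polynomial_le_expR (R : realType) (d K b : R) : 0 < d -> 0 <= K -> 0 <= b ->
  exists2 l0, 1 <= l0 & forall l, l0 <= l ->
    exists2 M : nat, K * l ^+ 2 <= M%:R & M.+1%:R * (3 + b * M%:R) <= expR (d * l).
Proof.
move=> d0 K0 b0; pose Q := (K + 2) * (3 + b * (K + 1)).
have Q0 : 0 <= Q by rewrite mulr_ge0 ?addr_ge0 ?mulr_ge0 ?addr_ge0.
have d5 : 0 < (d / 5) ^+ 5 by rewrite exprn_gt0 ?divr_gt0.
exists (Num.max 1 (Q / (d / 5) ^+ 5)); first by rewrite le_max lexx.
move=> l; rewrite ge_max => /andP[l1 lQ].
have l0 : 0 < l by exact: lt_le_trans l1.
have l2 : 1 <= l ^+ 2 by rewrite exprn_ege1.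
have Kl0 : 0 <= K * l ^+ 2 by rewrite mulr_ge0// exprn_ge0// ltW.
exists (Num.truncn (K * l ^+ 2)).+1; first by rewrite ltW// truncnS_gt.
set M := (Num.truncn _).+1.
have M_le : M%:R <= (K + 1) * l ^+ 2.
  rewrite /M -natr1 mulrDl mul1r lerD//.
  by case/andP: (truncn_itv Kl0).
have M1_le : M.+1%:R <= (K + 2) * l ^+ 2 by rewrite -natr1; lra.
have bM : 3 + b * M%:R <= (3 + b * (K + 1)) * l ^+ 2.
  have : b * M%:R <= b * ((K + 1) * l ^+ 2) by rewrite ler_wpM2l.
  lra.
apply: (@le_trans _ _ (Q * l ^+ 4)).
  rewrite (_ : Q * l ^+ 4 = (K + 2) * l ^+ 2 * ((3 + b * (K + 1)) * l ^+ 2)).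
    by rewrite ler_pM// addr_ge0// mulr_ge0.
  by rewrite /Q; ring.
rewrite ler_pdivrMr// in lQ.
have e5 : d * l / 5 <= expR (d * l / 5).
  by rewrite (le_trans _ (expR_ge1Dx _))// lerDr.
have -> : expR (d * l) = expR (d * l / 5) ^+ 5.
  by rewrite -expRM_natl; congr expR; field.
apply: (@le_trans _ _ ((d * l / 5) ^+ 5)); last first.
  by rewrite lerXn2r ?nnegrE ?expR_ge0// divr_ge0// mulr_ge0 ?ltW.
have -> : (d * l / 5) ^+ 5 = l * (d / 5) ^+ 5 * l ^+ 4 by field.
by rewrite ler_wpM2r// exprn_ge0// ltW.
Qed.

Section Main.
Variables (R : realType) (eta : probability (env R) R).
Variables (P : R.-pker (env R) ~> traj) (eps0 alpha : R).
Hypothesis iid : iid_env eta.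
Hypothesis quenched : quenched_family P.
Hypothesis eps0_gt0 : 0 < eps0.
Hypothesis elliptic0 : eta [set w | eps0 <= w 0%R <= 1 - eps0] = 1%E.
Hypothesis centered : ('E_eta[fun w => ln (rho 0 w)] = 0)%E.
Hypothesis nondegenerate : (0 < 'V_eta[fun w => ln (rho 0 w)])%E.
Hypothesis alpha_gt0 : 0 < alpha.

(** The window is from n1, about exp ((1 - 6 d) l), to n2, about
    exp l = 1 / r, so that the exponential weight is at least exp (-1) on it. *)
Lemma tilted_moment_lower_bound (d : R) : 0 < d -> d <= 8^-1 ->
  exists2 l0, 1 <= l0 & forall l, l0 <= l ->
  ((expR ((1 - 6 * d) * l * alpha - 1 - 2 * d * l) * (d ^+ 2 / 4))%:E <=
    tilted_moment eta P alpha (expR (- l)))%E.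
Proof.
move=> d0 d8; pose v := \int[eta]_w (elliptic_log_odds eps0 (w 0) ^+ 2).
have v0 : 0 < v by exact: variance_elliptic_log_odds.
have d2v : 0 < d ^+ 2 * v by rewrite mulr_gt0 ?exprn_gt0.
have K0 : 0 <= 4 / (d ^+ 2 * v) by rewrite divr_ge0 ?ltW.
have b0 : 0 <= 2 / eps0 by rewrite divr_ge0// ltW.
have [l1 l1_ge1 l1P] := polynomial_le_expR d0 K0 b0.
exists (Num.max l1 (- ln eps0 / d)); first by rewrite le_max l1_ge1.
move=> l; rewrite ge_max => /andP[l1l]; rewrite ler_pdivrMr// mulrC => Cl.
have l0 : 0 < l by apply: lt_le_trans (le_trans l1_ge1 l1l).
have [M KM MX] := l1P l l1l.
have [|A mA [etaA Agood]] :=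
  deep_valley_probability iid eps0_gt0 elliptic0 centered d0 d8 l0 Cl (M := M).
  move: KM; rewrite mulrAC ler_pdivrMr// -/v => KM.
  by rewrite (mulrC (d ^+ 2 * v)).
pose z := expR ((1 - 6 * d) * l).
have el1 : 1 <= expR l by rewrite -expR0 ler_expR ltW.
pose n1 := Num.truncn z; pose n2 := Num.truncn (expR l).
have n2_gt0 : (0 < n2)%N by rewrite truncn_gt0.
have n2_le : n2%:R <= expR l by rewrite truncn_le expR_ge0.
have n2_ge : expR l / 2 <= n2%:R.
  have : expR l < n2.+1%:R by exact: truncnS_gt.
  have : 1 <= n2%:R :> R by rewrite ler1n.
  rewrite -natr1; lra.
have n1_le : n1%:R <= z by rewrite truncn_le expR_ge0.
have := @tilted_moment_ge R eta P alpha alpha_gt0 quenched A (expR (- (2 * d * l)))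
  (d ^+ 2 / 4) z (expR (- l)) n1 n2 mA.
rewrite !expR_ge0 expR_gt0 => /(_ isT isT isT); set T := tilted_moment _ _ _ _ => lower.
rewrite (_ : expR _ * _ = z `^ alpha * expR (- 1) * (expR (- (2 * d * l)) * (d ^+ 2 / 4))).
  apply: lower => //.
  - move=> w /Agood[ew vw]; split.
      by move=> i; have /andP[? ?] := elliptic_gt0 eps0_gt0 (ew i); rewrite !ltW.
    apply: (quenched_window eps0_gt0 ew vw) => //.
    by rewrite mulrAC.
  - by rewrite ltW// truncnS_gt.
  - apply: (@le_trans _ _ (expR (- l) * expR l)); first by rewrite ler_wpM2l ?expR_ge0.
    by rewrite -expRD addNr expR0.
by rewrite [RHS]mulrA -expRM -!expRD; congr (expR _ * _); ring.
Qed.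

(** Upper and lower bounds together; the loss (6 alpha + 2) d in the exponent is
    made smaller than e / 2 by the choice of d, and the additive constants are
    absorbed by taking l large. *)
Lemma log_moment_ratio (e : R) : 0 < e ->
  exists l0, forall l, l0 <= l -> exists2 x : R,
    tilted_moment eta P alpha (expR (- l)) = x%:E /\ 0 < x &
    0 < l /\ `|alpha - ln x / l| <= e.
Proof.
move=> e0; pose d := Num.min 8^-1 (e / (4 * (3 * alpha + 1))).
have a31 : 0 < 4 * (3 * alpha + 1) by rewrite mulr_gt0// ltr_wpDl// mulr_ge0// ltW.
have d0 : 0 < d by rewrite lt_min invr_gt0 ltr0n divr_gt0.
have d8 : d <= 8^-1 by rewrite ge_min lexx.
have de : d * (4 * (3 * alpha + 1)) <= e.
  by rewrite -ler_pdivlMr// ge_min lexx orbT.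
have [l1 l1_ge1 l1P] := tilted_moment_lower_bound d0 d8.
pose B := 1 - ln (d ^+ 2 / 4).
pose D := ln (alpha `^ alpha).
exists (Num.max l1 (Num.max (2 * B / e) (D / e))) => l.
rewrite !ge_max => /andP[l1l]; rewrite !ler_pdivrMr// => /andP[Bl Dl].
have l0 : 0 < l by apply: lt_le_trans (le_trans l1_ge1 l1l).
have low := l1P l l1l; set T := tilted_moment _ _ _ _ in low *.
have up : (T <= (alpha `^ alpha * (expR (- l))^-1 `^ alpha)%:E)%E.
  by apply: tilted_moment_le => //; exact: expR_gt0.
have d24 : 0 < d ^+ 2 / 4 by rewrite divr_gt0// exprn_gt0.
case: T low up => [x| |]; rewrite ?leNye ?leye_eq ?leeNy_eq// !lee_fin => low up.
have x0 : 0 < x by apply: lt_le_trans low; rewrite mulr_gt0// expR_gt0.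
exists x => //; split=> //.
have aa : 0 < alpha `^ alpha by rewrite powR_gt0.
have ln_low : (1 - 6 * d) * l * alpha - 1 - 2 * d * l + ln (d ^+ 2 / 4) <= ln x.
  have E0 := expR_gt0 ((1 - 6 * d) * l * alpha - 1 - 2 * d * l).
  by move: low; rewrite -ler_ln ?posrE ?mulr_gt0// lnM ?posrE// expRK.
have ln_up : ln x <= D + alpha * l.
  have El : 0 < expR l `^ alpha by rewrite powR_gt0 ?expR_gt0.
  have : ln x <= ln (alpha `^ alpha * expR l `^ alpha).
    by rewrite ler_ln ?posrE ?mulr_gt0//; move: up; rewrite expRN invrK.
  by rewrite lnM ?posrE// [ln (expR l `^ _)]ln_powR expRK.
have h : d * (4 * (3 * alpha + 1)) * l <= e * l by rewrite ler_wpM2r// ltW.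
rewrite /B in Bl; rewrite ler_norml; apply/andP.
by split; rewrite -(ler_pM2r l0) mulrBl divfK ?gt_eqF//; lra.
Qed.
End Main.

Theorem proposition1p2 (R : realType) (eta : probability (env R) R)
    (P : R.-pker (env R) ~> traj) (eps0 alpha : R) :
  iid_env eta ->
  quenched_family P ->
  0 < eps0 ->
  eta [set w | eps0 <= w 0 <= 1 - eps0] = 1%E ->
  ('E_eta[fun w => ln (rho 0 w)] = 0)%E ->
  (0 < 'V_eta[fun w => ln (rho 0 w)])%E ->
  0 < alpha ->
  (lne (\int[annealed eta P]_s (tau R 1 s `^ alpha * expeR (- (r%:E * tau R 1 s))))
     / (ln r^-1)%:E)%E @[r --> 0^'+] --> alpha%:E.
Proof.
move=> iid quenched eps0_gt0 elliptic0 centered nondegenerate alpha_gt0.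
have ratio := log_moment_ratio iid quenched eps0_gt0 elliptic0 centered
  nondegenerate alpha_gt0.
have eventually (l0 : R) (Q : R -> Prop) : (forall l, l0 <= l -> Q (expR (- l))) ->
    \forall r \near 0^'+, Q r.
  move=> Ql; near=> r; have r0 : 0 < r by [].
  rewrite -[r]lnK ?posrE// -[ln r]opprK; apply: Ql.
  rewrite lerNr -[leRHS]expRK ler_ln ?posrE ?expR_gt0//.
  by near: r; apply: nbhs_right_le; exact: expR_gt0.
apply/fine_cvgP; split.
  have [l0 l0P] := ratio 1 ltr01; apply: (eventually l0) => l /l0P[x [xE x0] [l_gt0 _]].
  rewrite -/(tilted_moment _ _ _ _) xE lne_EFin// -expRN opprK expRK inver gt_eqF//.
apply/cvgrPdist_le => e e0; have [l0 l0P] := ratio e e0.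
apply: (eventually l0) => l /l0P[x [xE x0] [l_gt0 le_e]] /=.
by rewrite -/(tilted_moment _ _ _ _) xE lne_EFin// -expRN opprK expRK inver gt_eqF.
Unshelve. all: by end_near. Qed.
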